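(* Let $H\in(1/2,1)$, $\alpha\in(1-H,1/2)$, and let $\{B^H_t,t\ge 0\}$ be a fractional Brownian motion with Hurst parameter $H$. For any $\gamma>1/2$, the random variable $$ \xi_{H,\alpha,\gamma}=\sup_{0\le t_1<t_2\le t_1+1}\frac{|Z(t_1,t_2)|}{(t_2-t_1)^{H+\alpha-1}\left(|\log(t_2-t_1)|^{1/2}+1\right)\left(\log(t_2+2)\right)^{\gamma}} $$ is finite almost surely. Moreover, there exists $c_{H,\alpha,\gamma}>0$ such that $\mathsf{E}\left[\exp\{x\,\xi_{H,\alpha,\gamma}^2\}\right]<\infty$ for all $x<c_{H,\alpha,\gamma}$.
   Context: A fractional Brownian motion (fBm) with Hurst parameter $H$ is a centered Gaussian process $\{B^H_t,t\ge0\}$ with covariance $\mathsf{E}[B^H_tB^H_s]=\frac12(s^{2H}+t^{2H}-|t-s|^{2H})$; it is defined on a complete probability space and taken with (locally Hölder) continuous paths. For $0\le t_1<t_2$ one sets $$ Z(t_1,t_2)=\frac{e^{-i\pi\alpha}}{\Gamma(\alpha)}\left(\frac{B^H_{t_1}-B^H_{t_2}}{(t_2-t_1)^{1-\alpha}}+(1-\alpha)\int_{t_1}^{t_2}\frac{B^H_{t_1}-B^H_{u}}{(u-t_1)^{2-\alpha}}\,du\right), $$ i.e. $Z(t_1,t_2)=\left(D^{1-\alpha}_{t_2-}B^H_{t_2-}\right)(t_1)$ is the right-sided fractional derivative of order $1-\alpha$ on $[t_1,t_2]$ of $B^H_{t_2-}(x)=B^H_x-B^H_{t_2}$, evaluated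 at $t_1$. *)

(* Defs.v *)
From HB Require Import structures.
From mathcomp Require Import all_boot all_order all_algebra.
From mathcomp Require Import all_classical all_reals all_analysis.
From mathcomp Require Import measurable_realfun complex.
Set Implicit Arguments.
Unset Strict Implicit.
Unset Printing Implicit Defensive.
Import Order.TTheory GRing.Theory Num.Theory.
Import numFieldNormedType.Exports.
Local Open Scope classical_set_scope.
Local Open Scope ring_scope.

Section Gaussian.
Context {R : realType} {d : measure_display} {T : measurableType d}.
Variable P : probability T R.

(* Normal law with mean m and standard deviation s.  The case s = 0 is the
   Dirac mass at m, whereas normal_prob m 0 is the uniform law on [0, 1]. *)
Definition gaussian_law (m s : R) (A : set R) : \bar R :=
  if s == 0 then dirac m A else normal_prob m s A.

Definition is_gaussian (X : T -> R) : Prop :=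
  measurable_fun setT X /\
  exists m s : R, 0 <= s /\
    forall A : set R, measurable A -> P (X @^-1` A) = gaussian_law m s A.

(* A process is indexed by all of R, but only its values at times t >= 0 are
   ever constrained or used. *)
Definition gaussian_process (B : R -> T -> R) : Prop :=
  forall (n : nat) (t a : 'I_n -> R), (forall i, 0 <= t i) ->
    is_gaussian (fun w => \sum_(i < n) a i * B (t i) w).

(* The Hölder exponent b is allowed to depend on the compact interval. *)
Definition locally_holder (f : R -> R) : Prop :=
  forall M : R, exists b C : R, 0 < b /\
    forall s t : R, 0 <= s <= M -> 0 <= t <= M ->
      `|f t - f s| <= C * `|t - s| `^ b.

(* For a centered process the covariance of B t and B s is 'E_P[B t * B s]. *)
Definition fbm (H : R) (B : R -> T -> R) : Prop :=
  [/\ gaussian_process B,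
      forall t : R, 0 <= t -> ('E_P[B t] = 0)%E,
      forall s t : R, 0 <= s -> 0 <= t ->
        'E_P[B t \* B s]%E =
          (2^-1 * (s `^ (2 * H) + t `^ (2 * H) - `|t - s| `^ (2 * H)))%:E
    & forall w, locally_holder (B ^~ w)].

End Gaussian.

Section FractionalDerivative.
Context {R : realType}.

Definition Gamma (a : R) : R :=
  \int[lebesgue_measure]_(t in `]0, +oo[) (t `^ (a - 1) * expR (- t)).

Definition expi (theta : R) : R[i] := (cos theta +i* sin theta)%C.

Definition Z (alpha : R) (x : R -> R) (t1 t2 : R) : R[i] :=
  (expi (- (pi * alpha)) / (Gamma alpha)%:C
   * ((x t1 - x t2) / (t2 - t1) `^ (1 - alpha)
      + (1 - alpha) *
        \int[lebesgue_measure]_(u in `[t1, t2])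
          ((x t1 - x u) / (u - t1) `^ (2 - alpha)))%:C)%C.

(* The supremum is taken in the extended reals, so that its finiteness is a
   genuine assertion. *)
Definition xi {T : Type} (H alpha gamma : R) (B : R -> T -> R) (w : T) : \bar R :=
  ereal_sup [set (Normc.normc (Z alpha (B ^~ w) t.1 t.2) /
      ((t.2 - t.1) `^ (H + alpha - 1)
       * (`|ln (t.2 - t.1)| `^ 2^-1 + 1)
       * (ln (t.2 + 2)) `^ gamma))%:E
    | t in [set t : R * R | 0 <= t.1 /\ t.1 < t.2 <= t.1 + 1]].

End FractionalDerivative.

(* Main.v *)
Require Import Defs.
From HB Require Import structures.
From mathcomp Require Import all_boot all_order all_algebra.
From mathcomp Require Import all_classical all_reals all_analysis.
From mathcomp Require Import measurable_realfun complex.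
From mathcomp Require Import ring lra zify.
Set Implicit Arguments.
Unset Strict Implicit.
Unset Printing Implicit Defensive.
Import Order.TTheory GRing.Theory Num.Theory.
Import numFieldNormedType.Exports.
Local Open Scope classical_set_scope.
Local Open Scope ring_scope.

(** The theorem is a statement about the modulus of continuity of the
    paths. Put [osc h = h `^ H * (sqrt |ln h| + 1)]. If a path satisfies
    [|x t - x s| <= A * osc (t - s) * ln (t + 2) `^ gamma] for [s < t <= s
    + 1], then [xi <= K * A] with [K] depending on the parameters only
    ([xi_le_modulus]): since [H + alpha > 1], the singular factor [(u - t1)
    `^ (alpha - 2)] is integrable against [osc (u - t1)]. It remains to
    find a random [A] whose square has small exponential moments.

    Let [D m k] be the increment of the path over the dyadic interval with
    end points [k / 2 ^ m] and [(k + 1) / 2 ^ m]; it is Gaussian with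
    second moment [sigma_m ^ 2], where [sigma_m = 2 ^ (- m * H)].
    Everything is controlled by the single random series [S = sum_(m, k)
    e_m e_k exp (kappa (D m k / sigma_m)^2)], the [dyadic_energy], with
    [e_k = 1 / ((k + 1) (k + 2))]. Its mean is finite because the
    normalized increments have uniformly bounded exponential moments and
    the weights are summable ([integral_dyadic_energy_le]). Conversely each
    term is at most [S], so [kappa (D m k / sigma_m)^2] is at most [ln S -
    ln (e_m e_k)]. As the weights decrease only polynomially, the last
    logarithm is of order [m + ln (t + 2)] for increments located before
    the time [t], and therefore [|D m k| <= eta sigma_m (sqrt (m + 1)) (ln
    (t + 2)) ^ gamma] with [eta ^ 2] a multiple of [ln (1 + S) + 6]
    ([dyadic_energy_modulus]). Chaining along the dyadic approximations of
    [s] and [t] turns this bound into the modulus of continuity above, with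
    [A] a multiple of [eta] ([dyadic_modulus_continuity]). Hence [xi ^ 2 <=
    M * (ln (1 + S) + 6)], and [exp (x * xi ^ 2) <= exp 6 * (1 + S)]
    whenever [x < 1 / M].

    Measurability of the uncountable supremum [xi] comes from the event [S
    < oo]. There the substitution [u = s + h * v] and dominated convergence
    make [Z] continuous in both end points, so [xi] is the supremum over
    dyadic parameters ([xi_esups]). At each of these, [Z] is a measurable
    function of the outcome by Fubini, and completeness of the probability
    space transfers measurability to [xi] itself.

    The process is constrained at nonnegative times only, so [B t] is first
    replaced by [B (max 0 t)], whose paths are continuous on the whole
    line. *)

(** * Gaussian exponential moments *)

Section Gaussian_moments.
Context {R : realType}.
Local Notation mu := (@lebesgue_measure R).

(** The density is the Radon-Nikodym derivative of the normal law up to a null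
    set. *)
Lemma ge0_integral_normal_prob (m s : R) (f : R -> \bar R) :
  measurable_fun setT f -> (forall x, 0 <= f x)%E ->
  (\int[normal_prob m s]_x f x =
   \int[mu]_x (f x * (normal_pdf m s x)%:E))%E.
Proof.
move=> mf f0; have dom := @normal_prob_dominates R m s.
rewrite -(Radon_Nikodym_SigmaFinite.change_of_variables dom)//.
apply: ae_eq_integral => //.
- apply: emeasurable_funM => //; apply: (measurable_int mu).
  exact: Radon_Nikodym_SigmaFinite.f_integrable.
- apply: emeasurable_funM => //; apply/measurable_EFinP.
  exact: measurable_normal_pdf.
- apply: ae_eqe_mul2l; apply: integral_ae_eq => //.
  + exact: Radon_Nikodym_SigmaFinite.f_integrable.
  + by apply/measurable_EFinP; exact: measurable_normal_pdf.
  + by move=> E _ mE; rewrite -Radon_Nikodym_SigmaFinite.f_integral.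
Qed.

(** A lower bound for the density of the standard normal law between 1 and
    2. *)
Definition std_density_lb : R := normal_peak 1 * expR (- 2).

Lemma std_density_lb_gt0 : 0 < std_density_lb.
Proof. by rewrite mulr_gt0 ?expR_gt0// normal_peak_gt0. Qed.

Lemma std_density_lb_le1 : std_density_lb <= 1.
Proof.
have h2 : expR (- 2) <= 1 :> R by rewrite -[leRHS]expR0 ler_expR; lra.
have p2 : 1 <= Num.sqrt (1 ^+ 2 * pi *+ 2) :> R.
  rewrite -[leLHS]sqrtr1 ler_wsqrtr// expr1n mul1r.
  by have := @pi_ge2 R; rewrite -mulr_natr; lra.
have h1 : normal_peak 1 <= 1 :> R.
  by rewrite /normal_peak invf_le1// (lt_le_trans _ p2).
by rewrite /std_density_lb -[leRHS]mulr1 ler_pM ?expR_ge0 ?normal_peak_ge0.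
Qed.

Lemma normal_peakE (s : R) : 0 < s -> normal_peak s = normal_peak 1 / s.
Proof.
move=> s0; rewrite /normal_peak expr1n mul1r -mulrnAr sqrtrM ?sqr_ge0//.
by rewrite sqrtr_sqr gtr0_norm// invfM mulrC.
Qed.

(** On the two intervals at distance between [s] and [2 * s] from [m] the
    density is at least [std_density_lb / s]; on one of them the absolute value
    of the variable is at least [`|m| + s]. *)
Lemma normal_second_moment_ge (m s : R) : 0 < s ->
  ((std_density_lb * (`|m| + s) ^+ 2)%:E <=
   \int[normal_prob m s]_x (x ^+ 2)%:E)%E.
Proof.
move=> s0.
have mX2 : measurable_fun setT (fun x : R => (x ^+ 2)%:E).
  by apply/measurable_EFinP; exact: measurable_funX.
rewrite ge0_integral_normal_prob//; last by move=> x; rewrite lee_fin sqr_ge0.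
pose a := if 0 <= m then m + s else m - 2 * s.
have H x : x \in `[a, a + s] ->
    s ^+ 2 <= (x - m) ^+ 2 <= (2 * s) ^+ 2 /\ (`|m| + s) ^+ 2 <= x ^+ 2.
  rewrite in_itv/= /a; case: (ger0P m) => m0 /andP[xa xb].
  - by split; [apply/andP; split|]; nra.
  - by split; [apply/andP; split|]; nra.
have mn : measurable_fun setT (fun x : R => (normal_pdf m s x)%:E).
  by apply/measurable_EFinP; exact: measurable_normal_pdf.
apply: (@le_trans _ _ (\int[mu]_(x in `[a, (a + s)%R])
    (std_density_lb / s * (`|m| + s) ^+ 2)%:E)%E).
  rewrite integral_cst//= lebesgue_measure_itv/= lte_fin ltrDl s0.
  rewrite -EFinD -EFinM lee_fin le_eqVlt; apply/orP; left; apply/eqP.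
  by field; rewrite gt_eqF.
apply: (@le_trans _ _ (\int[mu]_(x in `[a, (a + s)%R])
    ((x ^+ 2)%:E * (normal_pdf m s x)%:E))%E); last first.
  apply: ge0_subset_integral => //; first exact: emeasurable_funM.
  by move=> x _; rewrite mule_ge0// lee_fin ?sqr_ge0// normal_pdf_ge0.
apply: ge0_le_integral => //.
- move=> x _; rewrite lee_fin mulr_ge0 ?sqr_ge0// divr_ge0 ?ltW//.
  exact: std_density_lb_gt0.
- by apply: measurable_funTS; exact: emeasurable_funM.
move=> x /H[/andP[xm1 xm2] xm]; rewrite -EFinM lee_fin mulrC.
apply: ler_pM => //; rewrite ?sqr_ge0//.
  by rewrite divr_ge0 ?ltW// std_density_lb_gt0.
rewrite normal_pdfE ?gt_eqF// normal_peakE// /std_density_lb mulrAC.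
rewrite ler_wpM2l//; first by rewrite divr_ge0 ?normal_peak_ge0 ?ltW.
rewrite ler_expR mulNr lerN2 ler_pdivrMr.
  by rewrite -mulr_natr; lra.
by rewrite pmulrn_lgt0// exprn_gt0.
Qed.

(** Splitting [x ^ 2 <= 2 * m ^ 2 + 2 * (x - m) ^ 2], the part in [m] costs
    the factor [expR 4^-1], and the part in [x - m] uses up half of the
    Gaussian exponent: what remains is [sqrt 2 <= 2] times the density of
    the normal law of mean [m] and standard deviation [sqrt 2 * s]. *)
Lemma normal_exp_sqr_le (m s : R) : 0 < s ->
  (\int[normal_prob m s]_x
     (expR (x ^+ 2 / (8 * (`|m| + s) ^+ 2)))%:E <=
   (2 * expR 4^-1)%:E)%E.
Proof.
move=> s0; set q := 8 * _.
have mq : measurable_fun setT (fun x : R => (expR (x ^+ 2 / q))%:E).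
  apply/measurable_EFinP; apply: measurableT_comp => //.
  by apply: measurable_funM => //; exact: measurable_funX.
rewrite ge0_integral_normal_prob//.
pose s' := Num.sqrt 2 * s.
have s'0 : 0 < s' by rewrite mulr_gt0 ?sqrtr_gt0.
have mn : measurable_fun setT (fun x : R => (normal_pdf m s' x)%:E).
  by apply/measurable_EFinP; exact: measurable_normal_pdf.
apply: (@le_trans _ _ (\int[mu]_x
   ((2 * expR 4^-1)%:E * (normal_pdf m s' x)%:E))%E); last first.
  rewrite ge0_integralZl//.
  - by rewrite integral_normal_pdf mule1.
  - by move=> x _; rewrite lee_fin normal_pdf_ge0.
apply: ge0_le_integral => //.
- by move=> x _; rewrite mule_ge0 ?lee_fin ?expR_ge0 ?normal_pdf_ge0.
- apply: emeasurable_funM => //; apply/measurable_EFinP.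
  exact: measurable_normal_pdf.
- exact: emeasurable_funM.
move=> x _; rewrite -!EFinM lee_fin !normal_pdfE ?gt_eqF//.
rewrite (normal_peakE s0) (normal_peakE s'0).
have s2 : s'^-1 * 2 >= s^-1.
  rewrite /s' invfM mulrAC ler_peMl ?invr_ge0 ?(ltW s0)//.
  rewrite mulrC ler_pdivlMr ?sqrtr_gt0// mul1r.
  rewrite -[X in _ <= X]ger0_norm// -sqrtr_sqr ler_sqrt; lra.
rewrite /normal_fun.
rewrite [leLHS](_ : _ = normal_peak 1 * (s^-1 * (expR (x ^+ 2 / q) *
    expR (- (x - m) ^+ 2 / (s ^+ 2 *+ 2))))); last by ring.
rewrite [leRHS](_ : _ = normal_peak 1 * (s'^-1 * 2 * (expR 4^-1 *
    expR (- (x - m) ^+ 2 / (s' ^+ 2 *+ 2))))); last by ring.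
rewrite ler_wpM2l ?normal_peak_ge0//.
rewrite ler_pM ?invr_ge0 ?(ltW s0) ?mulr_ge0 ?expR_ge0//.
rewrite -!expRD ler_expR /s' exprMn sqr_sqrtr//.
have ms : 0 < `|m| + s by rewrite ltr_wpDl.
have q0 : 0 < q by rewrite mulr_gt0// exprn_gt0.
have s20 : 0 < s ^+ 2 by rewrite exprn_gt0.
have -> : - (x - m) ^+ 2 / ((2 * s ^+ 2) *+ 2) =
    - (x - m) ^+ 2 / (s ^+ 2 *+ 2) + (x - m) ^+ 2 / (4 * s ^+ 2).
  by field; rewrite gt_eqF.
rewrite addrA [leRHS]addrAC lerD2r.
apply: (@le_trans _ _ ((2 * m ^+ 2 + 2 * (x - m) ^+ 2) / q)).
  rewrite ler_pM2r ?invr_gt0//; have := sqr_ge0 (x - 2 * m); nra.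
rewrite mulrDl; apply: lerD.
  rewrite ler_pdivrMr// /q.
  have : m ^+ 2 <= (`|m| + s) ^+ 2.
    by rewrite -(real_normK (num_real m)) lerXn2r ?nnegrE ?(ltW ms)// lerDl ltW.
  by lra.
rewrite ler_pdivrMr// mulrAC ler_pdivlMr ?mulr_gt0//.
have : s ^+ 2 <= (`|m| + s) ^+ 2.
  by rewrite lerXn2r ?nnegrE ?(ltW ms) ?(ltW s0)// lerDr.
have : 0 <= (x - m) ^+ 2 by rewrite sqr_ge0.
by rewrite /q; nra.
Qed.

End Gaussian_moments.

Section Gaussian_variables.
Context {R : realType} {d : measure_display} {T : measurableType d}.
Variable P : probability T R.

(** The hypothesis constrains the second moment only, not the mean: by
    [normal_second_moment_ge] it bounds both the mean and the standard
    deviation of the law by a multiple of [sigma]. *)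
Lemma gaussian_exp_sqr_le (X : T -> R) (sigma : R) :
  is_gaussian P X -> 0 < sigma ->
  (\int[P]_w (X w ^+ 2)%:E = (sigma ^+ 2)%:E)%E ->
  (\int[P]_w (expR (std_density_lb / 8 * (X w / sigma) ^+ 2))%:E <=
   (2 * expR 4^-1)%:E)%E.
Proof.
move=> [mX [m [s [s0 lawX]]]] sg0 EX2.
(* The normal law lives on [measurableTypeR R], whose display differs from the
   one of [R]. *)
have mX' : measurable_fun setT (X : T -> measurableTypeR R) by exact: mX.
pose Xm := HB.pack_for {mfun T >-> measurableTypeR R} X
  (isMeasurableFun.Build _ _ _ _ _ mX').
have tr (f : R -> R) (mf : measurable_fun setT f) (f0 : forall x, 0 <= f x) :
    (\int[P]_w (f (X w))%:E = \int[distribution P Xm]_x (f x)%:E)%E.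
  rewrite ge0_integral_distribution//; exact/measurable_EFinP.
have mE c : measurable_fun setT (fun x : R => expR (c * x ^+ 2)).
  by apply: measurableT_comp => //; apply: measurable_funM.
have mX2 : measurable_fun setT (fun x : R => x ^+ 2) by exact: measurable_funX.
pose c := std_density_lb / 8 / sigma ^+ 2 : R.
rewrite (eq_integral (fun w => (expR (c * X w ^+ 2))%:E)); last first.
  by move=> w _; rewrite exprMn exprVn /c; congr (expR _)%:E; ring.
rewrite (tr (fun x => expR (c * x ^+ 2)))//.
move: EX2; rewrite (tr (fun x => x ^+ 2))//; last by move=> ?; exact: sqr_ge0.
(* The degenerate case [s = 0] is a Dirac mass. *)
move: s0; rewrite le_eqVlt => /predU1P[s0|s0].
  have law0 : forall A, measurable A -> A `<=` setT ->
      distribution P Xm A = dirac m A.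
    move=> A mA _; rewrite /distribution/= /pushforward lawX//.
    by rewrite /gaussian_law -s0 eqxx.
  have eq0 (f : measurableTypeR R -> \bar R) : measurable_fun setT f ->
      (\int[distribution P Xm]_x f x = f m)%E.
    move=> mf; rewrite (eq_measure_integral (dirac (m : measurableTypeR R)))//.
    by rewrite integral_dirac// diracT mul1e.
  rewrite eq0; last by apply/measurable_EFinP; exact: mX2.
  rewrite eq0; last by apply/measurable_EFinP; exact: mE.
  move=> [m2]; rewrite lee_fin m2 /c divfK ?sqrf_eq0 ?gt_eqF//.
  apply: (@le_trans _ _ (expR 4^-1)).
    by rewrite ler_expR; have := @std_density_lb_le1 R; lra.
  by have := @expR_ge0 R 4^-1; lra.
have law1 : forall A, measurable A -> A `<=` setT ->
    distribution P Xm A = normal_prob m s A.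
  move=> A mA _; rewrite /distribution/= /pushforward lawX// /gaussian_law.
  by rewrite gt_eqF.
have eqn (f : measurableTypeR R -> \bar R) :
    (\int[distribution P Xm]_x f x = \int[normal_prob m s]_x f x)%E.
  exact: eq_measure_integral.
rewrite !eqn => EX2.
apply: le_trans (normal_exp_sqr_le m s0).
apply: ge0_le_integral => //.
- by apply/measurable_EFinP; exact: mE.
- apply/measurable_EFinP; apply: measurableT_comp => //.
  exact: measurable_funM.
move=> x _; rewrite lee_fin ler_expR mulrC ler_wpM2l ?sqr_ge0//.
have ms : 0 < `|m| + s by rewrite ltr_wpDl.
have := normal_second_moment_ge m s0; rewrite EX2 lee_fin => h.
rewrite /c -mulrA -invfM ler_pdivrMr ?mulr_gt0 ?exprn_gt0//.
rewrite mulrC ler_pdivlMr ?mulr_gt0 ?exprn_gt0//.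
by lra.
Qed.

End Gaussian_variables.

(** * Increments of fractional Brownian motion *)

Section fbm_increments.
Context {R : realType} {d : measure_display} {T : measurableType d}.
Variables (P : probability T R) (H : R) (B : R -> T -> R).
Hypotheses (H0 : 0 < H) (fB : fbm P H B).

Lemma fbm_measurable t : 0 <= t -> measurable_fun setT (B t).
Proof.
move=> t0; have [gB _ _ _] := fB.
have [] := gB 1%N (fun=> t) (fun=> 1) (fun=> t0).
rewrite (_ : (fun w => _) = B t)//.
by apply/funext => w; rewrite big_ord1 mul1r.
Qed.

Lemma fbm_increment_gaussian s t : 0 <= s -> 0 <= t ->
  is_gaussian P (fun w => B t w - B s w).
Proof.
move=> s0 t0; have [gB _ _ _] := fB.
rewrite (_ : (fun w => _) = (fun w => \sum_(i < 2)
    (if i == ord0 then 1 else -1) * B (if i == ord0 then t else s) w)).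
  by apply: gB => i; case: ifP.
by apply/funext => w; rewrite big_ord_recl big_ord1/= mul1r mulN1r.
Qed.

(** The covariance is given as an integral, and linearity may be applied to it
    only once the products are known to be integrable; this follows from the
    finiteness of the second moments. *)
Lemma fbm_integrableM s t : 0 <= s -> 0 <= t ->
  P.-integrable setT (fun w => (B t w * B s w)%:E).
Proof.
move=> s0 t0; have [_ _ cB _] := fB.
have mB u : 0 <= u -> measurable_fun setT (B u) by exact: fbm_measurable.
have i2 u : 0 <= u -> P.-integrable setT (fun w => (B u w ^+ 2)%:E).
  move=> u0; apply/integrableP; split.
    by apply/measurable_EFinP/measurable_funX/mB.
  under eq_integral do rewrite gee0_abs ?lee_fin ?sqr_ge0//.
  have := cB _ _ u0 u0; rewrite unlock => E.
  rewrite [ltLHS](_ : _ = \int[P]_w ((B u \* B u) w)%:E)%E; last first.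
    by apply: eq_integral => w _; rewrite expr2.
  by rewrite E ltry.
have mM : measurable_fun setT (fun w => (B t w * B s w)%:E).
  by apply/measurable_EFinP/measurable_funM; exact: mB.
apply: (le_integrable measurableT mM _
  (integrableD measurableT (i2 _ t0) (i2 _ s0))).
move=> w _; rewrite -EFinD !abse_EFin lee_fin.
rewrite [leRHS]ger0_norm ?addr_ge0 ?sqr_ge0//.
rewrite normrM -(real_normK (num_real (B t w))).
rewrite -(real_normK (num_real (B s w))).
have := sqr_ge0 (`|B t w| - `|B s w|).
have := normr_ge0 (B t w); have := normr_ge0 (B s w); nra.
Qed.

Lemma fbm_increment_variance s t : 0 <= s -> 0 <= t ->
  (\int[P]_w ((B t w - B s w) ^+ 2)%:E = (`|t - s| `^ (2 * H))%:E)%E.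
Proof.
move=> s0 t0; have [_ _ cB _] := fB.
have E u v : 0 <= u -> 0 <= v -> (\int[P]_w (B v w * B u w)%:E =
    (2^-1 * (u `^ (2 * H) + v `^ (2 * H) - `|v - u| `^ (2 * H)))%:E)%E.
  by move=> u0 v0; have := cB _ _ u0 v0; rewrite unlock.
have e0 u : `|u - u| `^ (2 * H) = 0.
  by rewrite subrr normr0 powR0// mulf_neq0// gt_eqF.
have i := fbm_integrableM.
rewrite (eq_integral (fun w => ((B t w * B t w)%:E + (B s w * B s w)%:E) -
    2%:E * (B t w * B s w)%:E))%E; last first.
  by move=> w _; rewrite -EFinM -EFinN -!EFinD; congr EFin; ring.
rewrite integralB//=; last 2 first.
- by apply: integrableD => //; exact: i.
- by apply: integrableZl => //; exact: i.
rewrite integralD//=; [|exact: i|exact: i].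
rewrite integralZl//=; last exact: i.
rewrite !E// !e0 -EFinM -EFinN -!EFinD; congr EFin.
by field.
Qed.

Lemma fbm_increment_exp_sqr_le s t : 0 <= s -> 0 <= t -> s != t ->
  (\int[P]_w (expR (std_density_lb / 8 *
                      ((B t w - B s w) / `|t - s| `^ H) ^+ 2))%:E <=
   (2 * expR 4^-1)%:E)%E.
Proof.
move=> s0 t0 st; apply: gaussian_exp_sqr_le => //.
- exact: fbm_increment_gaussian.
- by rewrite powR_gt0// normr_gt0 subr_eq0 eq_sym.
by rewrite fbm_increment_variance// mulrC powRrM powR_mulrn// powR_ge0.
Qed.

End fbm_increments.

(** * The dyadic energy of a path *)

Section dyadic_energy.
Context {R : realType}.

Definition dyadic (m k : nat) : R := k%:R / 2 ^+ m.

Definition dyadic_increment (x : R -> R) m k :=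
  x (dyadic m k.+1) - x (dyadic m k).

Lemma dyadic_ge0 m k : 0 <= dyadic m k.
Proof. by rewrite divr_ge0// exprn_ge0. Qed.

Lemma dyadicS m k : dyadic m k.+1 - dyadic m k = 2 ^- m.
Proof. by rewrite /dyadic -mulrBl -natr1 addrAC subrr add0r mul1r. Qed.

(** Both properties matter: the weights have a finite sum, and the logarithm of
    their inverses grows only like [ln k]. *)
Definition summable_weight (k : nat) : R := (k.+1%:R * k.+2%:R)^-1.

Lemma summable_weight_gt0 k : 0 < summable_weight k.
Proof. by rewrite invr_gt0 mulr_gt0. Qed.

Lemma sum_summable_weight_le1 :
  (\sum_(0 <= k <oo) (summable_weight k)%:E <= 1)%E.
Proof.
apply: lime_le.
  apply: is_cvg_nneseries => k _ _.
  by rewrite lee_fin ltW// summable_weight_gt0.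
apply: nearW => n; rewrite sumEFin lee_fin.
(* The sum telescopes. *)
suff -> : \sum_(0 <= k < n) summable_weight k = 1 - n.+1%:R^-1.
  by rewrite gerBl invr_ge0.
elim: n => [|n IH]; first by rewrite big_geq// invr1 subrr.
rewrite big_nat_recr//= IH /summable_weight -[n.+2%:R]natr1 -[n.+1%:R]natr1.
have n0 := @ler0n R n.
by field; rewrite !gt_eqF//; lra.
Qed.

Definition energy_term (H : R) (x : R -> R) (m k : nat) : R :=
  summable_weight m * summable_weight k *
  expR (std_density_lb / 8 *
        (dyadic_increment x m k / (2 ^- m) `^ H) ^+ 2).

Lemma energy_term_gt0 (H : R) x m k : 0 < energy_term H x m k.
Proof. by rewrite !mulr_gt0 ?expR_gt0 ?summable_weight_gt0. Qed.

Lemma energy_term_ge0 (H : R) x m k : (0 <= (energy_term H x m k)%:E)%E.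
Proof. by rewrite lee_fin ltW// energy_term_gt0. Qed.

Definition dyadic_energy (H : R) (x : R -> R) : \bar R :=
  (\sum_(0 <= m <oo) \sum_(0 <= k <oo) (energy_term H x m k)%:E)%E.

Lemma dyadic_energy_ge (H : R) x m k :
  ((energy_term H x m k)%:E <= dyadic_energy H x)%E.
Proof.
pose u a b := (energy_term H x a b)%:E.
have u0 a b : (0 <= u a b)%E by exact: energy_term_ge0.
apply: (@le_trans _ _ (\sum_(0 <= b <oo) u m b)%E).
  rewrite (@nneseriesD1 _ (u m) k xpredT)//=.
  by rewrite leeDl// nneseries_ge0.
have s0 a : (0 <= \sum_(0 <= b <oo) u a b)%E by exact: nneseries_ge0.
rewrite /dyadic_energy.
rewrite (@nneseriesD1 _ (fun a => \sum_(0 <= b <oo) u a b)%E m xpredT)//=.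
by rewrite leeDl// nneseries_ge0.
Qed.

Lemma dyadic_energy_ge0 (H : R) x : (0 <= dyadic_energy H x)%E.
Proof.
by do 2![apply: nneseries_ge0 => ? _ _]; exact: energy_term_ge0.
Qed.

End dyadic_energy.

Section measurable_series.
Context {R : realType} {d : measure_display} {T : measurableType d}.

Lemma measurable_nneseries (h : nat -> T -> \bar R) :
  (forall k x, 0 <= h k x)%E -> (forall k, measurable_fun setT (h k)) ->
  measurable_fun setT (fun x => \sum_(0 <= k <oo) h k x)%E.
Proof.
move=> h0 mh.
rewrite (_ : (fun x => _) = (fun x => \sum_(k <oo | k \in xpredT) h k x)%E).
  by apply: (@ge0_emeasurable_sum _ _ _ _ h xpredT) => // k x _ _; exact: h0.
by [].
Qed.

End measurable_series.

Section fbm_energy.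
Context {R : realType} {d : measure_display} {T : measurableType d}.
Variables (P : probability T R) (H : R) (B : R -> T -> R).
Hypotheses (H0 : 0 < H) (fB : fbm P H B).

Let term m k w : \bar R := (energy_term H (B ^~ w) m k)%:E.

Let term_ge0 m k w : (0 <= term m k w)%E. Proof. exact: energy_term_ge0. Qed.

Let normalized m k w : R :=
  expR (std_density_lb / 8 *
        (dyadic_increment (B ^~ w) m k / (2 ^- m) `^ H) ^+ 2).

Let measurable_normalized m k : measurable_fun setT (normalized m k).
Proof.
apply: measurableT_comp => //; apply: measurable_funM => //.
apply: measurable_funX; apply: measurable_funM => //.
by apply: measurable_funB; apply: (fbm_measurable fB); exact: dyadic_ge0.
Qed.

Let mterm m k : measurable_fun setT (term m k).
Proof.
apply/measurable_EFinP; apply: measurable_funM => //.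
exact: measurable_normalized.
Qed.

Lemma measurable_dyadic_energy :
  measurable_fun setT (fun w => dyadic_energy H (B ^~ w)).
Proof.
apply: measurable_nneseries => [m w|m]; last first.
  exact: (measurable_nneseries (term_ge0 m)).
by apply: nneseries_ge0 => k _ _; exact: term_ge0.
Qed.

(** By monotone convergence the mean is the sum of the means of the terms, each
    at most a constant times its weight. *)
Lemma integral_dyadic_energy_le :
  (\int[P]_w dyadic_energy H (B ^~ w) <= (2 * expR 4^-1)%:E)%E.
Proof.
have K0 : (0 <= (2 * expR 4^-1)%:E :> \bar R)%E.
  by rewrite lee_fin mulr_ge0// expR_ge0.
have w0 k : (0 <= (summable_weight k)%:E :> \bar R)%E.
  by rewrite lee_fin ltW// summable_weight_gt0.
rewrite integral_nneseries//; last 2 first.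
- by move=> m; exact: (measurable_nneseries (term_ge0 m)).
- by move=> m w _; apply: nneseries_ge0 => k _ _; exact: term_ge0.
apply: (@le_trans _ _
    (\sum_(0 <= m <oo) (2 * expR 4^-1)%:E * (summable_weight m)%:E)%E).
  apply: lee_nneseries => m _; first by move=> _; apply: integral_ge0 => w _;
    apply: nneseries_ge0 => k _ _; exact: term_ge0.
  rewrite (@integral_nneseries _ _ _ _ _ _ (term m))//.
  apply: (@le_trans _ _ (\sum_(0 <= k <oo)
      ((summable_weight m)%:E * (2 * expR 4^-1)%:E) *
      (summable_weight k)%:E)%E).
    apply: lee_nneseries => k _.
      by move=> _; apply: integral_ge0 => w _; exact: term_ge0.
    rewrite (eq_integral (fun w => (summable_weight m * summable_weight k)%:E *
      (normalized m k w)%:E)%E)//.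
    rewrite ge0_integralZl//=; last 3 first.
    - by apply/measurable_EFinP; exact: measurable_normalized.
    - by move=> w _; rewrite lee_fin expR_ge0.
    - by rewrite EFinM mule_ge0.
    rewrite [leRHS](_ : _ = (summable_weight m * summable_weight k)%:E *
        (2 * expR 4^-1)%:E)%E; last by rewrite -!EFinM mulrAC.
    rewrite lee_pmul2l ?lte_fin//; last first.
      by rewrite mulr_gt0// summable_weight_gt0.
    have := fbm_increment_exp_sqr_le H0 fB (dyadic_ge0 m k) (dyadic_ge0 m k.+1).
    rewrite dyadicS [`|2 ^- m|]ger0_norm ?invr_ge0 ?exprn_ge0//; apply.
    by rewrite eq_sym -subr_eq0 dyadicS invr_eq0 expf_eq0 andbC pnatr_eq0.
  rewrite nneseriesZl//.
  rewrite [leRHS]muleC -[leRHS]mule1.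
  apply: lee_wpmul2l; first exact: mule_ge0 (w0 m) K0.
  exact: sum_summable_weight_le1.
rewrite nneseriesZl//.
apply: le_trans (lee_wpmul2l K0 sum_summable_weight_le1) _.
by rewrite mule1.
Qed.

End fbm_energy.

(** * From the energy to the size of the dyadic increments *)

Section dyadic_modulus.
Context {R : realType}.
Implicit Types (x : R -> R) (H gamma eta s t h : R).

Definition dyadic_modulus H gamma x eta := forall m k,
  `|dyadic_increment x m k| <=
  eta * ((2 ^- m) `^ H * Num.sqrt m.+1%:R) * ln (dyadic m k.+1 + 2) `^ gamma.

Lemma ln2_ge_half : 2^-1 <= ln 2 :> R.
Proof.
rewrite -ler_expR lnK ?posrE// -[leLHS]invrK -expRN.
rewrite -[X in _ <= X]invrK lef_pV2 ?posrE ?expR_gt0 ?invr_gt0//.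
by apply: le_trans (expR_ge1Dx _); lra.
Qed.

Lemma ln_add2_ge0 t : 0 <= t -> 0 <= ln (t + 2).
Proof. by move=> t0; rewrite ln_ge0//; lra. Qed.

Lemma log_weight_le gamma s t : 0 <= gamma -> 0 <= s -> s <= t ->
  ln (s + 2) `^ gamma <= ln (t + 2) `^ gamma.
Proof.
move=> g0 s0 st; have t0 : 0 <= t by exact: le_trans st.
rewrite ge0_ler_powR ?nnegrE ?ln_add2_ge0//.
by rewrite ler_ln ?posrE ?lerD2r//; lra.
Qed.

(** Since [2 * l >= 1], raising [2 * l] to the power [2 * gamma >= 1] can only
    increase it: this is where [gamma >= 1 / 2] enters. *)
Lemma powR_dominates gamma l : 2^-1 <= gamma -> 2^-1 <= l ->
  1 <= 2 `^ (2 * gamma) * l `^ (2 * gamma) /\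
  2 * l <= 2 `^ (2 * gamma) * l `^ (2 * gamma).
Proof.
move=> g1 l1; rewrite -powRM//; last by lra.
have l2 : 1 <= 2 * l by lra.
have : 2 * l <= (2 * l) `^ (2 * gamma) by apply: le1r_powR => //; lra.
by move=> h; split => //; lra.
Qed.

(** A term of the energy is at most the energy; taking logarithms bounds
    the squared normalized increment by [ln (1 + s)] plus the logarithms of
    the inverse weights. With [t = (k + 1) / 2 ^ m] the latter are at most
    [4 * (m + 1) + 2 * ln (t + 2)], because [k + 2 <= 2 ^ (m + 1) * (t +
    2)]. *)
Lemma dyadic_energy_modulus H gamma x s : 2^-1 <= gamma ->
  dyadic_energy H x = s%:E ->
  0 < s /\ dyadic_modulus H gamma x
    (Num.sqrt (8 / std_density_lb * 2 `^ (2 * gamma) * (ln (1 + s) + 6))).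
Proof.
move=> g1 Es.
have wexp m k : energy_term H x m k <= s.
  by rewrite -lee_fin -Es; exact: dyadic_energy_ge.
have s0 : 0 < s by exact: lt_le_trans (energy_term_gt0 _ _ _ _) (wexp 0%N 0%N).
split=> // m k; move: (wexp m k); rewrite /energy_term.
set i := dyadic_increment x m k; set sg := (2 ^- m) `^ H.
have sg0 : 0 < sg by rewrite powR_gt0// invr_gt0 exprn_gt0.
have a0 := @std_density_lb_gt0 R; set a := std_density_lb in a0 *.
move=> E.
have ln1s : 0 <= ln (1 + s) by apply: ln_ge0; rewrite lerDl ltW.
(* [l] is the logarithm of the right end point of the dyadic interval. *)
set l := ln (dyadic m k.+1 + 2).
have l1 : 2^-1 <= l.
  apply: le_trans ln2_ge_half _; rewrite ler_ln ?posrE//.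
    by rewrite lerDr dyadic_ge0.
  by rewrite ltr_wpDl// dyadic_ge0.
set N := m.+1%:R : R.
have N1 : 1 <= N by rewrite ler1n.
have lnm : ln (m.+2%:R) <= N.
  by rewrite -natr1 addrC; apply: le_ln1Dx; rewrite /N; lra.
have lnm' : ln (m.+1%:R) <= N.
  by apply: le_trans lnm; rewrite ler_ln ?posrE// ler_nat.
have lnk : ln (k.+2%:R) <= N + l.
  apply: (@le_trans _ _ (ln (2 ^+ m.+1 * (dyadic m k.+1 + 2)))).
    rewrite ler_ln ?posrE//; last first.
      by rewrite mulr_gt0 ?exprn_gt0// ltr_wpDl ?dyadic_ge0.
    rewrite /dyadic mulrDr exprS.
    have p1 : 1 <= 2 ^+ m :> R by apply: exprn_ege1; lra.
    rewrite [X in X + _](_ : _ = 2 * k.+1%:R); last by field; lra.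
    rewrite -natr1; have : 1 <= k.+1%:R :> R by rewrite ler1n.
    by nra.
  rewrite lnM ?posrE ?exprn_gt0//; last by rewrite ltr_wpDl ?dyadic_ge0.
  rewrite lerD2r lnXn// -[ln 2 *+ _]mulr_natr -/N.
  have : ln 2 <= 1 :> R by rewrite -[2](_ : 1 + 1 = _)//; apply: le_ln1Dx; lra.
  by move=> ?; rewrite ler_piMl//; lra.
have lnk' : ln (k.+1%:R) <= N + l.
  by apply: le_trans lnk; rewrite ler_ln ?posrE// ler_nat.
have E2 : a / 8 * (i / sg) ^+ 2 <= ln (1 + s) + (4 * N + 2 * l).
  have : expR (a / 8 * (i / sg) ^+ 2) <=
      (1 + s) * (m.+1%:R * m.+2%:R) * (k.+1%:R * k.+2%:R).
    have := E; rewrite /summable_weight -invfM mulrC ler_pdivrMr ?mulr_gt0//.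
    move=> /le_trans; apply; rewrite -[leRHS]mulrA ler_wpM2r ?mulr_ge0//.
    by rewrite lerDr.
  rewrite -ler_ln ?posrE ?expR_gt0 ?mulr_gt0// ?addr_gt0// expRK.
  rewrite !lnM ?posrE ?mulr_gt0// ?addr_gt0//.
  by lra.
have [d1 d2] := powR_dominates g1 l1.
have l0 : 0 <= l by lra.
set c := 2 `^ (2 * gamma) in d1 d2 *; set L := l `^ (2 * gamma) in d1 d2 *.
have E3 : ln (1 + s) + (4 * N + 2 * l) <= (ln (1 + s) + 6) * N * (c * L).
  rewrite -mulrA mulrDl.
  have : ln (1 + s) <= ln (1 + s) * (N * (c * L)).
    by rewrite ler_peMr// -[leLHS]mulr1 ler_pM//; lra.
  have : 2 * l <= N * (c * L) by rewrite -[leLHS]mul1r ler_pM//; lra.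
  have : N <= N * (c * L) by rewrite ler_peMr//; lra.
  by lra.
have E4 : i ^+ 2 <= 8 / a * c * (ln (1 + s) + 6) * (sg ^+ 2 * N) * L.
  have -> : i ^+ 2 = (8 / a * sg ^+ 2) * (a / 8 * (i / sg) ^+ 2).
    by field; rewrite !gt_eqF.
  apply: (@le_trans _ _ (8 / a * sg ^+ 2 * ((ln (1 + s) + 6) * N * (c * L)))).
    rewrite ler_wpM2l//; last exact: le_trans E3.
    by rewrite mulr_ge0 ?sqr_ge0// divr_ge0// ltW.
  by rewrite le_eqVlt; apply/orP; left; apply/eqP; ring.
have c0 : 0 < c by rewrite powR_gt0.
rewrite -sqrtr_sqr.
have -> : l `^ gamma = Num.sqrt L.
  rewrite /L mulrC powRrM powR_mulrn ?powR_ge0//.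
  by rewrite sqrtr_sqr ger0_norm ?powR_ge0.
have -> : sg = Num.sqrt (sg ^+ 2) by rewrite sqrtr_sqr gtr0_norm.
have C0 : 0 <= 8 / a * c * (ln (1 + s) + 6).
  by rewrite mulr_ge0 ?addr_ge0// mulr_ge0 ?(ltW c0)// divr_ge0// ltW.
have s20 : 0 <= sg ^+ 2 by rewrite sqr_ge0.
rewrite -(sqrtrM _ s20) -(sqrtrM _ C0) -sqrtrM; last first.
  by rewrite mulr_ge0// mulr_ge0//; lra.
exact: ler_wsqrtr.
Qed.

End dyadic_modulus.

(** * The local modulus of continuity *)

Section oscillation.
Context {R : realType}.
Variable H : R.

Definition osc (h : R) : R := h `^ H * (Num.sqrt `|ln h| + 1).

Lemma osc_ge0 h : 0 <= osc h.
Proof. by rewrite mulr_ge0 ?powR_ge0// addr_ge0. Qed.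

(** From [ln y < y] at [y = v `^ (- b)], the product [v `^ b * |ln v|] is
    at most [1 / b]; then take square roots. *)
Lemma powR_half_sqrt_ln (b v : R) : 0 < b -> 0 < v <= 1 ->
  v `^ (b / 2) * (Num.sqrt `|ln v| + 1) <= 1 + (Num.sqrt b)^-1.
Proof.
move=> b0 /andP[v0 v1].
have vb : v `^ (b / 2) <= 1.
  by rewrite -[leRHS](powRr0 v) ger_powR ?v0// divr_ge0// ltW.
have vb0 : 0 <= v `^ (b / 2) by exact: powR_ge0.
rewrite mulrDr mulr1 addrC lerD//.
have l0 : ln v <= 0 by rewrite ln_le0.
have key : v `^ b * `|ln v| <= b^-1.
  rewrite ler0_norm// -(ler_pM2l b0) divff ?gt_eqF//.
  have vb1 : 0 < v `^ b by exact: powR_gt0.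
  have := @ln_sublinear _ (v `^ b)^-1; rewrite invr_gt0 => /(_ vb1)/ltW.
  rewrite lnV ?posrE// ln_powR => h.
  by rewrite mulrCA mulrN mulrC -ler_pdivlMr// mul1r.
have -> : v `^ (b / 2) = Num.sqrt (v `^ b).
  by rewrite -powR12_sqrt ?powR_ge0// -powRrM.
by rewrite -sqrtrM ?powR_ge0// -sqrtrV ?ler_wsqrtr// ltW.
Qed.

(** Shrinking the scale from [h] to [h * v] costs the logarithm of [v], which
    any small power of [v] absorbs. *)
Lemma osc_scale (b h v : R) : 0 < b -> 0 < h -> 0 < v <= 1 ->
  osc (h * v) <= osc h * (1 + (Num.sqrt b)^-1) * v `^ (H - b / 2).
Proof.
move=> b0 h0 v01; have /andP[v0 v1] := v01.
have h1 := powR_half_sqrt_ln b0 v01.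
rewrite /osc powRM ?(ltW h0) ?(ltW v0)// lnM//.
have hs : Num.sqrt `|ln h + ln v| + 1 <=
    (Num.sqrt `|ln h| + 1) * (Num.sqrt `|ln v| + 1).
  set a := Num.sqrt `|ln h|; set c := Num.sqrt `|ln v|.
  have a0 : 0 <= a by exact: sqrtr_ge0.
  have c0 : 0 <= c by exact: sqrtr_ge0.
  have : Num.sqrt `|ln h + ln v| <= a + c.
    rewrite -[leRHS]ger0_norm ?addr_ge0// -[leRHS]sqrtr_sqr ler_wsqrtr//.
    apply: le_trans (ler_normD _ _) _.
    have a2 : a ^+ 2 = `|ln h| by rewrite sqr_sqrtr.
    have c2 : c ^+ 2 = `|ln v| by rewrite sqr_sqrtr.
    by rewrite -a2 -c2; nra.
  by nra.
apply: (@le_trans _ _ (h `^ H * v `^ H *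
    ((Num.sqrt `|ln h| + 1) * (Num.sqrt `|ln v| + 1)))).
  by rewrite ler_wpM2l// mulr_ge0 ?powR_ge0.
have -> : v `^ H = v `^ (H - b / 2) * v `^ (b / 2).
  by rewrite -powRD ?subrK// (gt_eqF v0) implybT.
rewrite [leLHS](_ : _ = h `^ H * (Num.sqrt `|ln h| + 1) * v `^ (H - b / 2) *
  (v `^ (b / 2) * (Num.sqrt `|ln v| + 1))); last by ring.
rewrite [leRHS](_ : _ = h `^ H * (Num.sqrt `|ln h| + 1) * v `^ (H - b / 2) *
  (1 + (Num.sqrt b)^-1)); last by ring.
by rewrite ler_wpM2l// !mulr_ge0 ?powR_ge0// addr_ge0.
Qed.

Definition has_modulus (gamma : R) (x : R -> R) (A : R) :=
  forall s t, 0 <= s -> s < t -> t <= s + 1 ->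
  `|x t - x s| <= A * osc (t - s) * ln (t + 2) `^ gamma.

End oscillation.

(** * Dyadic approximation of a time *)

Section dyadic_floor.
Context {R : realType}.
Implicit Type t : R.

Definition dyadic_index (n : nat) t := Num.truncn (t * 2 ^+ n).

Lemma dyadic_indexP n t : 0 <= t ->
  (dyadic_index n t)%:R <= t * 2 ^+ n < (dyadic_index n t).+1%:R.
Proof. by move=> t0; apply: truncn_itv; rewrite mulr_ge0// exprn_ge0. Qed.

Lemma dyadic_index_le n t : 0 <= t -> dyadic n (dyadic_index n t) <= t.
Proof.
move=> t0; rewrite /dyadic ler_pdivrMr ?exprn_gt0//.
by have /andP[] := dyadic_indexP n t0.
Qed.

Lemma dyadic_index_gt n t : 0 <= t ->
  t < dyadic n (dyadic_index n t) + 2 ^- n.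
Proof.
move=> t0; rewrite /dyadic -[X in _ + X]mul1r -mulrDl natr1.
rewrite ltr_pdivlMr ?exprn_gt0//.
by have /andP[] := dyadic_indexP n t0.
Qed.

Lemma dyadic_step_lt t : 0 < t ->
  exists N, forall n, (N <= n)%N -> (2^-1 : R) ^+ n < t.
Proof.
move=> t0; have : (2^-1 : R) ^+ n @[n --> \oo] --> 0.
  by apply: cvg_expr; rewrite ger0_norm ?invr_ge0// invf_lt1//; lra.
move=> /cvgrPdist_lt/(_ _ t0)[N _ hN]; exists N => n /hN.
by rewrite /= sub0r normrN ger0_norm ?exprn_ge0 ?invr_ge0.
Qed.

Lemma cvg_dyadic_index t : 0 <= t ->
  dyadic n (dyadic_index n t) @[n --> \oo] --> t.
Proof.
move=> t0; apply/cvgrPdist_le => e /dyadic_step_lt[N hN].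
exists N => // n /hN/ltW/(le_trans _); apply.
rewrite ger0_norm ?subr_ge0 ?dyadic_index_le// exprVn.
by have := dyadic_index_gt n t0; lra.
Qed.

End dyadic_floor.

Section nat_between.
Implicit Types a b : nat.

Lemma eq_or_succ a b : (b < a.+1)%N -> (a < b.+2)%N -> (a == b) || (a == b.+1).
Proof. lia. Qed.

Lemma eq_double_or_succ a b : (a < 2 * b.+1)%N -> (2 * b < a.+1)%N ->
  (a == (2 * b)%N) || (a == (2 * b).+1).
Proof. lia. Qed.

Lemma leqS_double a : (a.+2 <= 2 * a.+1)%N.
Proof. lia. Qed.

End nat_between.

(** * Chaining *)

Section chaining.
Context {R : realType}.
Variables (H gamma : R).
Hypotheses (H12 : 2^-1 < H) (H1 : H <= 1) (gamma0 : 0 <= gamma).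

Let q : R := 2^-1 `^ H.

Let q0 : 0 < q. Proof. by rewrite powR_gt0. Qed.

Let powR_dyadic m : (2 ^- m) `^ H = q ^+ m.
Proof.
have h0 : 0 <= 2^-1 :> R by rewrite invr_ge0.
by rewrite -exprVn -(powR_mulrn m h0) powRAC powR_mulrn// ltW.
Qed.

(** The ratio of consecutive scales is at most [r], and [r < 1] because
    [H > 1 / 2]. *)
Let r : R := q * Num.sqrt 2.

Let r_lt1 : r < 1.
Proof.
have q2 : q < Num.sqrt 2^-1.
  rewrite -powR12_sqrt// /q /powR !ifF ?gt_eqF//.
  by rewrite ltr_expR ltr_nM2r// ln_lt0//; lra.
have s2 : 0 < Num.sqrt 2 :> R by rewrite sqrtr_gt0.
rewrite /r -(ltr_pdivlMr _ _ s2) mul1r.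
by rewrite -sqrtrV.
Qed.

Let r_gt0 : 0 < r. Proof. by rewrite mulr_gt0// sqrtr_gt0. Qed.

Let scale m : R := q ^+ m * Num.sqrt m.+1%:R.

Let scale_ge0 m : 0 <= scale m.
Proof. by rewrite mulr_ge0 ?sqrtr_ge0// exprn_ge0// ltW. Qed.

Let scaleS m : scale m.+1 <= r * scale m.
Proof.
rewrite /scale /r exprS.
rewrite [leRHS](_ : _ = q * q ^+ m * (Num.sqrt 2 * Num.sqrt m.+1%:R)).
  rewrite ler_wpM2l//; first by rewrite mulr_ge0 ?exprn_ge0// ltW.
  by rewrite -sqrtrM// ler_wsqrtr// -natrM ler_nat leqS_double.
by ring.
Qed.

(** An upper bound for the sum of the scales of the levels above [m]; by
    [tailS] partial sums of the scales telescope, which spares any series. *)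
Let tail m : R := r / (1 - r) * scale m.

Let tail_ge0 m : 0 <= tail m.
Proof.
rewrite /tail mulr_ge0// divr_ge0 ?(ltW r_gt0)// subr_ge0; exact: ltW.
Qed.

Let tailS m : scale m.+1 + tail m.+1 <= tail m.
Proof.
have s0 := scale_ge0 m; have sS := scaleS m.
rewrite /tail [leLHS](_ : _ = scale m.+1 / (1 - r)); last first.
  by field; rewrite subr_eq0 gt_eqF.
rewrite [leRHS]mulrAC ler_wpM2r// invr_ge0 subr_ge0; exact: ltW.
Qed.

Variables (x : R -> R) (eta : R).
Hypotheses (cx : continuous x) (eta0 : 0 <= eta).
Hypothesis dx : dyadic_modulus H gamma x eta.

Let L t : R := ln (t + 2) `^ gamma.

Let leL (s t : R) : 0 <= s -> s <= t -> L s <= L t.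
Proof. exact: log_weight_le. Qed.

Let L0 t : 0 <= L t. Proof. exact: powR_ge0. Qed.

Local Notation idx := dyadic_index.

Let increment_le m k (t : R) : dyadic m k.+1 <= t ->
  `|x (dyadic m k.+1) - x (dyadic m k)| <= eta * scale m * L t.
Proof.
move=> kt; apply: le_trans (dx m k) _; rewrite powR_dyadic.
rewrite ler_wpM2l ?(mulr_ge0 eta0 (scale_ge0 m))//.
exact: (leL (dyadic_ge0 _ _) kt).
Qed.

(** The approximation of [t] at level [n.+1] either agrees with the one at
    level [n] or lies one dyadic step of level [n.+1] above it. *)
Let refine_le n (t : R) : 0 <= t ->
  `|x (dyadic n.+1 (idx n.+1 t)) - x (dyadic n (idx n t))| <=
  eta * scale n.+1 * L t.
Proof.
move=> t0; set k := idx n t.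
have E : dyadic n k = dyadic n.+1 (2 * k) :> R.
  by rewrite /dyadic exprS natrM; field; rewrite expf_neq0.
have /orP[/eqP ->|/eqP kE] :
    (idx n.+1 t == (2 * k)%N) || (idx n.+1 t == (2 * k).+1).
  have /andP[a1 a2] := dyadic_indexP n t0.
  have /andP[b1 b2] := dyadic_indexP n.+1 t0.
  rewrite exprS mulrCA in b1 b2.
  have c1 : (idx n.+1 t < 2 * k.+1)%N.
    by rewrite -(ltr_nat R) natrM; rewrite -/k in a2; lra.
  have c2 : (2 * k < (idx n.+1 t).+1)%N.
    by rewrite -(ltr_nat R) natrM; rewrite -/k in a1; lra.
  exact: eq_double_or_succ.
  by rewrite -E subrr normr0 (mulr_ge0 (mulr_ge0 eta0 (scale_ge0 _)) (L0 _)).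
rewrite E kE; apply: increment_le; rewrite -kE; exact: dyadic_index_le.
Qed.

Let chain_le m n (t : R) : 0 <= t ->
  `|x (dyadic (m + n) (idx (m + n) t)) - x (dyadic m (idx m t))| <=
  eta * (tail m - tail (m + n)) * L t.
Proof.
move=> t0; elim: n => [|n IH]; first by rewrite addn0 !subrr normr0 mulr0 mul0r.
rewrite addnS; set a := x (dyadic (m + n).+1 _); set b := x (dyadic m _).
set c := x (dyadic (m + n) (idx (m + n) t)) in IH.
rewrite [a - b](_ : _ = (a - c) + (c - b)); last by ring.
apply: le_trans (ler_normD _ _) _.
apply: le_trans (lerD (refine_le (m + n) t0) IH) _.
rewrite -mulrDl ler_wpM2r// -mulrDr ler_wpM2l//.
by have := tailS (m + n); lra.
Qed.

(** Continuity of the path lets the level tend to infinity in [chain_le]. *)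
Let limit_le m (t : R) : 0 <= t ->
  `|x t - x (dyadic m (idx m t))| <= eta * tail m * L t.
Proof.
move=> t0.
have c : `|x (dyadic (m + n) (idx (m + n) t)) - x (dyadic m (idx m t))|
   @[n --> \oo] --> `|x t - x (dyadic m (idx m t))|.
  apply: cvg_norm; apply: cvgB; last exact: cvg_cst.
  apply: (cvg_comp _ x); last exact: cx.
  under eq_fun do rewrite addnC.
  by have := cvg_dyadic_index t0; rewrite -(cvg_shiftn m).
apply: (cvgr_to_le c); apply: nearW => n.
apply: le_trans (chain_le m n t0) _.
by rewrite ler_wpM2r// ler_wpM2l// gerBl.
Qed.

Definition chaining_constant : R := 4 * (2 * (r / (1 - r)) + 1).

Lemma chaining_constant_gt0 : 0 < chaining_constant.
Proof.
have : 0 < r / (1 - r) by rewrite divr_gt0// subr_gt0.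
by rewrite /chaining_constant; lra.
Qed.

(** Two times at distance at most [2 ^- m] have equal or adjacent
    approximations of level [m]. *)
Let near_le m (s t : R) : 0 <= s -> s <= t -> t - s <= 2 ^- m ->
  `|x t - x s| <= eta * ((2 * (r / (1 - r)) + 1) * scale m) * L t.
Proof.
move=> s0 st stm; have t0 : 0 <= t by exact: le_trans st.
have p2 : 0 < 2 ^+ m :> R by rewrite exprn_gt0.
have mid : `|x (dyadic m (idx m t)) - x (dyadic m (idx m s))| <=
    eta * scale m * L t.
  have /orP[/eqP->|/eqP kE] : (idx m t == idx m s) || (idx m t == (idx m s).+1).
    have /andP[a1 a2] := dyadic_indexP m t0.
    have /andP[b1 b2] := dyadic_indexP m s0.
    have st' : s * 2 ^+ m <= t * 2 ^+ m by rewrite ler_pM2r.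
    have ts' : t * 2 ^+ m <= s * 2 ^+ m + 1.
      by rewrite -lerBlDl -mulrBl -ler_pdivlMr// mul1r.
    have c1 : (idx m s < (idx m t).+1)%N by rewrite -(ltr_nat R); lra.
    have c2 : (idx m t < (idx m s).+2)%N.
      by rewrite -(ltr_nat R) -[(idx m s).+2%:R]natr1; lra.
    exact: eq_or_succ.
    by rewrite subrr normr0 (mulr_ge0 (mulr_ge0 eta0 (scale_ge0 _)) (L0 _)).
  by rewrite kE; apply: increment_le; rewrite -kE; exact: dyadic_index_le.
set a := x (dyadic m (idx m t)) in mid; set b := x (dyadic m (idx m s)) in mid.
have ha : `|x t - a| <= eta * tail m * L t by exact: limit_le.
have hb : `|b - x s| <= eta * tail m * L t.
  rewrite distrC; apply: le_trans (limit_le m s0) _.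
  by rewrite ler_wpM2l ?(mulr_ge0 eta0 (tail_ge0 m))//; exact: leL.
rewrite (_ : x t - x s = (x t - a) + (a - b) + (b - x s)); last by ring.
apply: le_trans (ler_normD _ _) _.
apply: le_trans (lerD (ler_normD _ _) (lexx _)) _.
apply: le_trans (lerD (lerD ha mid) hb) _.
by rewrite /tail le_eqVlt; apply/orP; left; apply/eqP; ring.
Qed.

(** The level [m] is chosen with [2 ^- m.+1 < t - s <= 2 ^- m], so that the
    scale of level [m] is comparable to [osc H (t - s)]. *)
Lemma dyadic_modulus_continuity :
  has_modulus H gamma x (eta * chaining_constant).
Proof.
move=> s t s0 st ts1; rewrite /osc; set h := t - s.
have h0 : 0 < h by rewrite subr_gt0.
have h1 : h <= 1 by rewrite /h; lra.
have exm : exists m, (2^-1 : R) ^+ m.+1 < h.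
  by have [N hN] := dyadic_step_lt h0; exists N; exact: hN.
case: (ex_minnP exm) => m hm minm.
have hm' : h <= 2 ^- m.
  case: m hm minm => [|m] hm minm; first by rewrite expr0 invr1.
  by rewrite leNgt -exprVn; apply/negP => /minm; rewrite ltnn.
apply: le_trans (near_le s0 (ltW st) hm') _.
have K0 : 0 < r / (1 - r) by rewrite divr_gt0// subr_gt0.
have qh : q ^+ m <= 2 * h `^ H.
  rewrite -powR_dyadic; apply: (@le_trans _ _ ((2 * h) `^ H)).
    have H0 : 0 <= H by apply: le_trans (ltW H12); rewrite invr_ge0.
    have u0 : 0 <= 2 ^- m :> R by rewrite invr_ge0 exprn_ge0.
    have v0 : 0 <= 2 * h by lra.
    by apply: ge0_ler_powR => //; move: hm; rewrite exprS exprVn; lra.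
  rewrite powRM ?(ltW h0)// ler_wpM2r ?powR_ge0//.
  by rewrite ler1_powR//; lra.
have sm : Num.sqrt m.+1%:R <= 2 * (Num.sqrt `|ln h| + 1).
  have l0 : ln h <= 0 by rewrite ln_le0.
  have mln : m%:R * ln 2 <= `|ln h|.
    rewrite ler0_norm// -lerN2 opprK mulr_natl -lnXn// -lnV ?posrE ?exprn_gt0//.
    by rewrite ler_ln ?posrE ?invr_gt0 ?exprn_gt0.
  set u := Num.sqrt `|ln h|.
  have u0 : 0 <= u by rewrite sqrtr_ge0.
  have u2 : u ^+ 2 = `|ln h| by rewrite sqr_sqrtr.
  rewrite -[leRHS]ger0_norm ?mulr_ge0 ?addr_ge0// -sqrtr_sqr ler_wsqrtr//.
  rewrite -natr1; have := @ln2_ge_half R; have m0 := @ler0n R m.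
  by rewrite -u2 in mln; nra.
have sc : scale m <= 4 * (h `^ H * (Num.sqrt `|ln h| + 1)).
  rewrite /scale [leRHS](_ : _ = (2 * h `^ H) * (2 * (Num.sqrt `|ln h| + 1))).
    by rewrite ler_pM ?exprn_ge0 ?sqrtr_ge0// ltW.
  by ring.
rewrite ler_wpM2r// -[leRHS]mulrA ler_wpM2l// /chaining_constant.
rewrite [leRHS](_ : _ = (2 * (r / (1 - r)) + 1) *
  (4 * (h `^ H * (Num.sqrt `|ln h| + 1)))); last by ring.
by rewrite ler_wpM2l//; lra.
Qed.

End chaining.

(** * Two facts on the Lebesgue integral *)

Section power_integral.
Context {R : realType}.
Local Notation mu := (@lebesgue_measure R).

Lemma powR_continuous (p v : R) : 0 < v ->
  {for v, continuous (fun u : R => u `^ p)}.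
Proof.
move=> v0; apply: differentiable_continuous; apply/derivable1_diffP.
by apply: derivable_powR; rewrite in_itv/= v0.
Qed.

Lemma integral_powR_away0 (p e : R) : 0 < e < 1 ->
  (\int[mu]_(v in `[e, 1%R]) (p * v `^ (p - 1))%:E = (1 - e `^ p)%:E)%E.
Proof.
move=> /andP[e0 e1].
have pos v : v \in `[e, 1] -> 0 < v.
  by rewrite in_itv/= => /andP[ev _]; exact: lt_le_trans ev.
rewrite (@continuous_FTC2 _ _ (@powR R ^~ p) e 1)//.
- by rewrite powR1.
- apply: continuous_in_subspaceT => v /[!inE]/pos v0.
  have : {for v, continuous (fun u : R => p * u `^ (p - 1))}.
    by apply: cvgM; [exact: cvg_cst|exact: powR_continuous].
  exact.
- split.
  + move=> v /subset_itv_oo_cc/pos v0.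
    by apply: derivable_powR; rewrite in_itv/= v0.
  + by apply: cvg_at_right_filter; exact: powR_continuous.
  + by apply: cvg_at_left_filter; exact: powR_continuous.
- move=> v /subset_itv_oo_cc/pos v0.
  by rewrite powR_derive1// in_itv/= v0.
Qed.

(** Monotone convergence along the intervals from [1 / (n + 2)] to [1], on
    which the fundamental theorem of calculus gives at most [1 / p]. *)
Lemma integrable_powR (p : R) : 0 < p ->
  mu.-integrable `[0, 1] (fun v => (v `^ (p - 1))%:E).
Proof.
move=> p0.
have mp : measurable_fun setT (fun v : R => (v `^ (p - 1))%:E).
  by apply/measurable_EFinP; exact: measurable_powR.
apply/integrableP; split; first exact: measurable_funTS.
under eq_integral do rewrite gee0_abs ?lee_fin ?powR_ge0//.
rewrite -integral_itv_obnd_cbnd; last exact: measurable_funTS.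
pose F n : set (measurableTypeR R) := `[n.+2%:R^-1, 1]%classic.
have -> : `]0, 1]%classic = \bigcup_n F n.
  apply/seteqP; split => v /=.
    rewrite in_itv/= => /andP[v0 v1].
    exists (Num.truncn v^-1) => //; rewrite /F/= in_itv/= v1 andbT.
    rewrite -[leRHS]invrK lef_pV2 ?posrE ?invr_gt0//.
    have vi : 0 <= v^-1 by rewrite invr_ge0 ltW.
    have /andP[_ vn] := truncn_itv vi.
    by rewrite ltW// (lt_le_trans vn)// ler_nat.
  by move=> [n _]; rewrite /F/= !in_itv/= => /andP[+ ->]; rewrite andbT;
    apply: lt_le_trans; rewrite invr_gt0.
have mF n : measurable (F n) by exact: measurable_itv.
apply: (@le_lt_trans _ _ (p^-1)%:E); last exact: ltry.
have c : (\int[mu]_(v in F i) (v `^ (p - 1))%:E @[i --> \oo] -->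
    \int[mu]_(v in \bigcup_i F i) (v `^ (p - 1))%:E)%E.
  apply: ge0_nondecreasing_set_cvg_integral => //.
  - apply/nondecreasing_seqP => n; rewrite subsetEset /F => v /=.
    rewrite !in_itv/= => /andP[h ->]; rewrite andbT; apply: le_trans h.
    by rewrite lef_pV2 ?posrE// ler_nat.
  - by move=> n; exact: measurable_funTS.
  - by move=> n v _; rewrite lee_fin powR_ge0.
rewrite -(cvg_lim _ c)//; apply: lime_le; first exact: cvgP c.
apply: nearW => n.
have e01 : 0 < (n.+2%:R^-1 : R) < 1.
  by rewrite invr_gt0 ltr0n/= invf_lt1// ltr1n.
rewrite -(@lee_pmul2l _ p%:E) ?lte_fin//.
rewrite -ge0_integralZl//; last 3 first.
- exact: measurable_funTS.
- by move=> v _; rewrite lee_fin powR_ge0.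
- by rewrite lee_fin ltW.
under eq_integral do rewrite -EFinM.
rewrite integral_powR_away0// -EFinM divff ?gt_eqF// lee_fin.
by rewrite gerBl powR_ge0.
Qed.

End power_integral.

Section affine_substitution.
Context {R : realType}.
Local Notation mu := (@lebesgue_measure R).
Variables (s h : R).
Hypothesis h0 : 0 < h.

Let phi (v : measurableTypeR R) : measurableTypeR R := s + h * v.

Let k : {nonneg R} := NngNum (ltW h0).

Let mphi : measurable_fun setT phi.
Proof.
have : measurable_fun setT (fun v : R => s + h * v).
  by apply: measurable_funD => //; apply: measurable_funM.
exact.
Qed.

(** Named explicitly because the measure structure of a pushforward takes the
    measurability of the map as an argument. *)
Let nu : {measure set (measurableTypeR R) -> \bar R} :=
  measure_function_pushforward__canonical__measure_function_Measure mu mphi.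

(** Both sides are measures that agree on half-open intervals. *)
Lemma lebesgue_measure_affine (A : set R) : measurable A ->
  mu A = (h%:E * pushforward mu (fun v => s + h * v)%R A)%E.
Proof.
move=> mA; change (mu A = mscale k nu A).
apply: lebesgue_measure_unique => //= _ [[a b]] _ <-.
rewrite /mscale/= /nu/= /pushforward.
have -> : phi @^-1` `]a, b] = `]((a - s) / h), ((b - s) / h)]%classic.
  apply/seteqP; split => v /=; rewrite !in_itv/= /phi;
    by rewrite ltr_pdivrMr// ler_pdivlMr// ltrBlDl lerBrDl mulrC.
rewrite !lebesgue_measure_itv/= !lte_fin ltr_pM2r ?invr_gt0// ltrD2r.
case: ifP => _; last by rewrite mule0.
by rewrite -!EFinD -EFinM; congr EFin; field; rewrite gt_eqF.
Qed.

Lemma ge0_integral_affine (f : R -> \bar R) :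
  measurable_fun setT f -> (forall u, 0 <= f u)%E ->
  (\int[mu]_(u in `[s, (s + h)%R]) f u =
   h%:E * \int[mu]_(v in `[0%R, 1%R]) f (s + h * v)%R)%E.
Proof.
move=> mf f0.
rewrite (eq_measure_integral (mscale k nu))/=; last first.
  by move=> A mA _; rewrite lebesgue_measure_affine.
rewrite ge0_integral_mscale//=; last exact: measurable_funTS.
rewrite ge0_integral_pushforward//; last exact: measurable_funTS.
congr (_ * integral _ _ _)%E.
apply/seteqP; split => v /=; rewrite !in_itv/= /phi;
  by rewrite lerDl lerD2l pmulr_rge0// ger_pMr.
Qed.

(** Integrability rules out the indeterminate difference of the infinite
    positive and negative parts. *)
Lemma Rintegral_affine (f : R -> R) : measurable_fun setT f ->
  mu.-integrable `[0, 1] (fun v => (f (s + h * v))%:E) ->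
  \int[mu]_(u in `[s, s + h]) f u =
  h * \int[mu]_(v in `[0, 1]) f (s + h * v).
Proof.
move=> mf fi; rewrite /Rintegral.
have mfE : measurable_fun setT (EFin \o f) by exact/measurable_EFinP.
rewrite integralE ge0_integral_affine; last 2 first.
- exact: measurable_funepos.
- by move=> u; exact: funepos_ge0.
rewrite ge0_integral_affine; last 2 first.
- exact: measurable_funeneg.
- by move=> u; exact: funeneg_ge0.
have m01 : measurable (`[0, 1]%classic : set (measurableTypeR R)).
  exact: measurable_itv.
have fp := integrable_pos_fin_num m01 fi.
have fn := integrable_neg_fin_num m01 fi.
rewrite [X in _ = _ * fine X]integralE; move: fp fn.
set Ip := (\int[mu]_(v in _) _ v)%E; set In := (\int[mu]_(v in _) _ v)%E.
move=> fp fn; transitivity (fine (h%:E * Ip - h%:E * In)).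
  congr (fine (_ * _ - _ * _)); apply: eq_integral => v _;
    by rewrite ?funeposE ?funenegE.
by rewrite -(fineK fp) -(fineK fn) -!EFinM -!EFinN -!EFinD/= mulrBr.
Qed.

End affine_substitution.

(** * The fractional derivative of a path with given modulus *)

Section fractional_derivative.
Context {R : realType}.
Local Notation mu := (@lebesgue_measure R).
Variables (H alpha gamma : R).
Hypotheses (aH : 1 - H < alpha) (a1 : alpha < 1) (gamma0 : 0 <= gamma).

Let b : R := H + alpha - 1.

Let b0 : 0 < b. Proof. by have := aH; rewrite /b; lra. Qed.

Definition difference_kernel (x : R -> R) s h v : R :=
  (x s - x (s + h * v)) * v `^ (alpha - 2).

(** Up to the factor [h `^ (alpha - 1) / Gamma alpha] and a phase, this is
    [Z alpha x s (s + h)] after the substitution [u = s + h * v]. *)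
Definition scaled_derivative (x : R -> R) s h : R :=
  (x s - x (s + h)) +
  (1 - alpha) * \int[mu]_(v in `[0, 1]) difference_kernel x s h v.

Let C1 : R := 1 + (Num.sqrt b)^-1.

Let C1_ge1 : 1 <= C1. Proof. by rewrite lerDl invr_ge0. Qed.

Lemma measurable_difference_kernel x s h : continuous x ->
  measurable_fun setT (difference_kernel x s h).
Proof.
move=> cx; apply: measurable_funM; last exact: measurable_powR.
apply: measurable_funB => //.
apply: measurableT_comp; first exact: continuous_measurable_fun.
by apply: measurable_funD => //; apply: measurable_funM.
Qed.

Variables (x : R -> R) (A : R).
Hypotheses (cx : continuous x) (A0 : 0 <= A) (mx : has_modulus H gamma x A).

Let L t : R := ln (t + 2) `^ gamma.

Let leL (s t : R) : 0 <= s -> s <= t -> L s <= L t.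
Proof. exact: log_weight_le. Qed.

(** The loss [v `^ (- (b / 2))] of [osc_scale] leaves the exponent
    [H - b / 2 + alpha - 2 = b / 2 - 1], which is still integrable at [0]. *)
Lemma difference_kernel_le (s h v : R) : 0 <= s -> 0 < h <= 1 -> 0 <= v <= 1 ->
  `|difference_kernel x s h v| <=
  A * osc H h * L (s + h) * C1 * v `^ (b / 2 - 1).
Proof.
move=> s0 /andP[h0 h1] /andP[v0 v1]; rewrite /difference_kernel.
(* At [v = 0] the kernel vanishes by the convention [0 `^ p = 0]. *)
move: v0; rewrite le_eqVlt => /predU1P[<-|v0].
  rewrite powR0; last by have := a1; lra.
  rewrite mulr0 normr0 !mulr_ge0 ?osc_ge0 ?powR_ge0//.
  by apply: le_trans C1_ge1.
have hv0 : 0 < h * v by rewrite mulr_gt0.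
have hvh : h * v <= h by rewrite ler_piMr// ltW.
rewrite normrM [X in _ * X]ger0_norm ?powR_ge0// distrC.
apply: (@le_trans _ _ ((A * (osc H h * C1 * v `^ (H - b / 2)) * L (s + h)) *
  v `^ (alpha - 2))).
  rewrite ler_wpM2r ?powR_ge0//.
  apply: le_trans (mx s0 _ _) _; [by rewrite ltrDl|by lra|].
  have -> : s + h * v - s = h * v by ring.
  apply: ler_pM; rewrite ?mulr_ge0 ?osc_ge0 ?powR_ge0//.
    by rewrite ler_wpM2l// osc_scale// v0.
  by apply: leL; lra.
have -> : v `^ (b / 2 - 1) = v `^ (H - b / 2) * v `^ (alpha - 2).
  by rewrite -powRD ?(gt_eqF v0) ?implybT//; congr (_ `^ _); rewrite /b; lra.
by rewrite le_eqVlt; apply/orP; left; apply/eqP; ring.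
Qed.

Let m01 : measurable (`[0, 1]%classic : set (measurableTypeR R)).
Proof. exact: measurable_itv. Qed.

Let ipow := @integrable_powR R (b / 2) (divr_gt0 b0 (ltr0n R 2)).

Lemma integrable_difference_kernel (s h : R) : 0 <= s -> 0 < h <= 1 ->
  mu.-integrable `[0, 1] (EFin \o difference_kernel x s h).
Proof.
move=> s0 h01.
pose c := A * osc H h * L (s + h) * C1.
apply: (@le_integrable _ _ _ mu _ m01 _
  (fun v => (c%:E * (v `^ (b / 2 - 1))%:E)%E)).
- apply: measurable_funTS; apply/measurable_EFinP.
  exact: measurable_difference_kernel.
- move=> v; rewrite /= in_itv/= => v01.
  rewrite lee_fin [leRHS]ger0_norm.
    exact: difference_kernel_le.
  by apply: le_trans (difference_kernel_le s0 h01 v01); exact: normr_ge0.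
- exact: integrableZl.
Qed.

Definition power_mass : R :=
  \int[mu]_(v in `[0, 1]) (v `^ ((H + alpha - 1) / 2 - 1)).

Definition derivative_constant : R :=
  1 + (1 - alpha) * ((1 + (Num.sqrt (H + alpha - 1))^-1) * power_mass).

Lemma scaled_derivative_le (s h : R) : 0 <= s -> 0 < h <= 1 ->
  `|scaled_derivative x s h| <=
  A * derivative_constant * osc H h * ln (s + h + 2) `^ gamma.
Proof.
move=> s0 h01; have /andP[h0 h1] := h01.
have i := integrable_difference_kernel s0 h01.
rewrite /scaled_derivative; apply: le_trans (ler_normD _ _) _.
have e1 : `|x s - x (s + h)| <= A * osc H h * L (s + h).
  rewrite distrC; apply: le_trans (mx s0 _ _) _; [by lra|by lra|].
  by have -> : s + h - s = h by ring.
have e2 : `|\int[mu]_(v in `[0, 1]) difference_kernel x s h v| <=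
    A * osc H h * L (s + h) * C1 * power_mass.
  apply: le_trans (le_normr_Rintegral _ i) _ => //.
  rewrite /power_mass -RintegralZl//.
  apply: le_Rintegral => //.
  - exact: integrable_norm.
  - exact: (integrableZl m01 (A * osc H h * L (s + h) * C1) ipow).
  - by move=> v; rewrite /= in_itv/= => v01; exact: difference_kernel_le.
apply: le_trans (lerD e1 (lexx _)) _.
have a1' : 0 <= 1 - alpha by rewrite subr_ge0 ltW.
rewrite normrM [`|1 - alpha|]ger0_norm//.
apply: (@le_trans _ _ (A * osc H h * L (s + h) + (1 - alpha) *
   (A * osc H h * L (s + h) * C1 * power_mass))).
  by rewrite lerD2l ler_wpM2l.
rewrite le_eqVlt /derivative_constant; apply/orP; left; apply/eqP.
by rewrite /C1 /b /L; ring.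
Qed.

(** The phase has modulus one, and after the substitution [u = s + h * v] the
    boundary term and the integral carry the same power of [h]. *)
Lemma normc_Z (s h : R) : 0 <= s -> 0 < h <= 1 ->
  Normc.normc (Z alpha x s (s + h)) =
  `|(Gamma alpha)^-1| * (h `^ (alpha - 1) * `|scaled_derivative x s h|).
Proof.
move=> s0 h01; have /andP[h0 h1] := h01.
have sh : s + h - s = h by ring.
have kE v : 0 <= v -> (x s - x (s + h * v)) / (s + h * v - s) `^ (2 - alpha) =
    h `^ (alpha - 2) * difference_kernel x s h v.
  move=> v0; rewrite /difference_kernel.
  have -> : s + h * v - s = h * v by ring.
  rewrite powRM ?(ltW h0)// -[2 - alpha]opprB !powRN invfM !invrK; ring.
have ik := integrable_difference_kernel s0 h01.
rewrite /Z sh.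
rewrite (@Rintegral_affine _ s h h0
  (fun u => (x s - x u) / (u - s) `^ (2 - alpha))); last 2 first.
- apply: measurable_funM.
    by apply: measurable_funB => //; exact: continuous_measurable_fun.
  rewrite (_ : (fun u => _) = (fun u => (u - s) `^ (alpha - 2))).
    apply: (@measurableT_comp _ _ _ _ _ _ (fun v : R => v `^ (alpha - 2))).
      exact: measurable_powR.
    exact: measurable_funB.
  by apply/funext => u; rewrite -powRN opprB.
- apply: (eq_integrable m01 (fun v => ((h `^ (alpha - 2))%:E *
    (difference_kernel x s h v)%:E)%E)); last exact: integrableZl.
  by move=> v; rewrite inE/= in_itv/= => /andP[v0 _]; rewrite kE// EFinM.
have -> : \int[mu]_(v in `[0, 1])
    ((x s - x (s + h * v)) / (s + h * v - s) `^ (2 - alpha)) =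
  h `^ (alpha - 2) * \int[mu]_(v in `[0, 1]) difference_kernel x s h v.
  rewrite -RintegralZl//.
  apply: eq_Rintegral => v; rewrite inE/= in_itv/= => /andP[v0 _].
  exact: kE.
have normcR (r : R) : Normc.normc (r%:C)%C = `|r|.
  by rewrite /Normc.normc/= expr0n/= addr0 sqrtr_sqr.
have norme (t : R) : Normc.normc (expi t) = 1.
  by rewrite /Normc.normc/= cos2Dsin2 sqrtr1.
rewrite !Normc.normcM norme Normc.normcV !normcR mul1r normfV; congr (_ * _).
rewrite -[X in _ = X * _](ger0_norm (powR_ge0 h (alpha - 1))) -normrM.
congr (`|_|); rewrite /scaled_derivative mulrDr; congr (_ + _).
  by rewrite -powRN opprB mulrC.
have -> : h `^ (alpha - 1) = h * h `^ (alpha - 2).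
  rewrite -{2}(powRr1 (ltW h0)) -powRD ?(gt_eqF h0) ?implybT//.
  by congr (_ `^ _); ring.
by ring.
Qed.

(** The quantity whose supremum is [xi], in terms of the left end point [s] and
    the length [h] ([xi_ratioE]). *)
Definition xi_ratio s h : R :=
  `|(Gamma alpha)^-1| * `|scaled_derivative x s h| /
  (osc H h * ln (s + h + 2) `^ gamma).

Lemma xi_ratioE (s h : R) : 0 <= s -> 0 < h <= 1 ->
  Normc.normc (Z alpha x s (s + h)) /
  (h `^ (H + alpha - 1) * (`|ln h| `^ 2^-1 + 1) * ln (s + h + 2) `^ gamma) =
  xi_ratio s h.
Proof.
move=> s0 h01; have /andP[h0 h1] := h01.
rewrite normc_Z// /xi_ratio /osc powR12_sqrt//.
have -> : h `^ (H + alpha - 1) = h `^ (alpha - 1) * h `^ H.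
  by rewrite -powRD ?(gt_eqF h0) ?implybT//; congr (_ `^ _); ring.
have p0 : 0 < h `^ (alpha - 1) by exact: powR_gt0.
have q0 : 0 < h `^ H by exact: powR_gt0.
have w0 : 0 < Num.sqrt `|ln h| + 1 by rewrite ltr_wpDl// sqrtr_ge0.
have l0 : 0 < ln (s + h + 2) `^ gamma by rewrite powR_gt0// ln_gt0//; lra.
by field; rewrite !gt_eqF.
Qed.

Let weight_gt0 (s h : R) : 0 <= s -> 0 < h ->
  0 < osc H h * ln (s + h + 2) `^ gamma.
Proof.
move=> s0 h0; rewrite mulr_gt0//.
  by rewrite mulr_gt0 ?powR_gt0// ltr_wpDl// sqrtr_ge0.
by rewrite powR_gt0// ln_gt0//; lra.
Qed.

Lemma xi_ratio_le (s h : R) : 0 <= s -> 0 < h <= 1 ->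
  xi_ratio s h <= `|(Gamma alpha)^-1| * derivative_constant * A.
Proof.
move=> s0 h01; have /andP[h0 h1] := h01.
rewrite /xi_ratio ler_pdivrMr; last exact: weight_gt0.
rewrite -!mulrA ler_wpM2l//.
apply: le_trans (scaled_derivative_le s0 h01) _.
by rewrite /osc le_eqVlt; apply/orP; left; apply/eqP; ring.
Qed.

Lemma xi_ratio_ge0 (s h : R) : 0 <= s -> 0 < h -> 0 <= xi_ratio s h.
Proof.
move=> s0 h0; apply: divr_ge0; first by rewrite mulr_ge0.
exact/ltW/weight_gt0.
Qed.

Lemma osc_le_C1 (h : R) : 0 < h <= 1 -> osc H h <= C1.
Proof.
move=> h01; have /andP[h0 h1] := h01.
have := @osc_scale _ H b 1 h b0 ltr01 h01.
rewrite mul1r => /le_trans; apply.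
rewrite /osc ln1 normr0 sqrtr0 add0r powR1 !mul1r ler_piMr//.
rewrite -[leRHS](powRr0 h) ger_powR//.
by have := aH; have := a1; rewrite /b; lra.
Qed.

(** Dominated convergence: the domain of integration is fixed, and
    [difference_kernel_le] dominates all kernels of the sequence at once, as
    [osc H] is bounded on the unit interval. *)
Lemma cvg_scaled_derivative (s_ h_ : nat -> R) (s h : R) :
  0 <= s -> 0 < h <= 1 ->
  (forall n, 0 <= s_ n <= s) -> (forall n, 0 < h_ n <= 1) ->
  s_ @ \oo --> s -> h_ @ \oo --> h ->
  scaled_derivative x (s_ n) (h_ n) @[n --> \oo] --> scaled_derivative x s h.
Proof.
move=> s0 h01 s_s h_1 cs ch.
have cxn (u : nat -> R) (l : R) : u @ \oo --> l -> x (u n) @[n --> \oo] --> x l.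
  by move=> ul; apply: (cvg_comp _ x ul); exact: cx.
apply: cvgD.
  by apply: cvgB; [exact: cxn|apply: cxn; exact: cvgD].
apply: cvgM; first exact: cvg_cst.
pose c := A * C1 * L (s + 1) * C1.
have [] := @dominated_convergence _ _ _ mu _ m01
  (fun n v => (difference_kernel x (s_ n) (h_ n) v)%:E)
  (fun v => (difference_kernel x s h v)%:E)
  (fun v => (c%:E * (v `^ (b / 2 - 1))%:E)%E).
- move=> n; apply: measurable_funTS; apply/measurable_EFinP.
  exact: measurable_difference_kernel.
- apply: measurable_funTS; apply/measurable_EFinP.
  exact: measurable_difference_kernel.
- apply: aeW => v _; apply: cvg_EFin; first exact: nearW.
  apply: cvgM; last exact: cvg_cst.
  apply: cvgB; first exact: cxn.
  by apply: cxn; apply: cvgD => //; apply: cvgM => //; exact: cvg_cst.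
- exact: integrableZl.
- apply: aeW => v n; rewrite /= in_itv/= => v01; rewrite lee_fin.
  have /andP[sn0 sns] := s_s n; have /andP[hn0 hn1] := h_1 n.
  apply: le_trans (difference_kernel_le sn0 (h_1 n) v01) _.
  rewrite ler_wpM2r ?powR_ge0// /c ler_wpM2r//; first exact: le_trans C1_ge1.
  apply: ler_pM; rewrite ?mulr_ge0 ?osc_ge0 ?powR_ge0//.
    by rewrite ler_wpM2l// osc_le_C1.
  by apply: leL; lra.
move=> _ _; rewrite /Rintegral => c1.
have i : mu.-integrable `[0, 1] (EFin \o difference_kernel x s h).
  exact: integrable_difference_kernel.
have := fine_cvg _; apply.
rewrite fineK//; exact: integrable_fin_num.
Qed.

End fractional_derivative.
(** * Measurability of the fractional derivative in the outcome *)

Section joint_measurability.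
Context {R : realType} {d : measure_display} {T : measurableType d}.
Local Notation mu := (@lebesgue_measure R).

Lemma measurable_dyadic_cell n k :
  measurable ([set v | dyadic_index n v = k] : set (measurableTypeR R)).
Proof.
have mlt j : measurable
    ([set v | (dyadic_index n v <= j)%N] : set (measurableTypeR R)).
  rewrite (_ : [set v | _] = `]-oo, (j.+1%:R / 2 ^+ n)[%classic).
    exact: measurable_itv.
  by apply/seteqP; split => v /=;
    rewrite in_itv/= /dyadic_index truncn_le_nat ltr_pdivlMr// exprn_gt0.
case: k => [|k].
  rewrite (_ : [set v | _] = [set v | (dyadic_index n v <= 0)%N])//.
  by apply/seteqP; split => v /=; rewrite leqn0 => /eqP.
rewrite (_ : [set v | _] = [set v | (dyadic_index n v <= k.+1)%N] `\`
    [set v | (dyadic_index n v <= k)%N]); first exact: measurableD.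
apply/seteqP; split => v /=; first by move=> ->; rewrite ltnn.
by move=> [a /negP]; rewrite -ltnNge => b; apply/eqP; rewrite eqn_leq a.
Qed.

(** A process with measurable marginals and continuous paths is the limit of
    processes that are constant in time on dyadic cells. *)
Lemma measurable_continuous_process (G : R -> T -> R) :
  (forall t, measurable_fun setT (G t)) -> (forall w, continuous (G ^~ w)) ->
  measurable_fun setT
    (fun z : measurableTypeR R * T => G (Num.max 0 z.1) z.2).
Proof.
move=> mG cG.
pose Gn n (z : measurableTypeR R * T) := G (dyadic n (dyadic_index n z.1)) z.2.
apply: (@measurable_fun_cvg _ _ _ _ Gn) => [n|[v w] _].
  pose E k := [set z : measurableTypeR R * T | dyadic_index n z.1 = k].
  have mE k : measurable (E k).
    have := @measurable_fst _ _ (measurableTypeR R) T measurableT _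
      (measurable_dyadic_cell n k).
    by rewrite setTI.
  have <- : \bigcup_k E k = setT.
    by apply/seteqP; split => // z _; exists (dyadic_index n z.1).
  apply/measurable_fun_bigcup => // k.
  apply: (@eq_measurable_fun _ _ _ _ (E k) (fun z => G (dyadic n k) z.2)).
    by move=> z /[!inE] Ez; rewrite /Gn Ez.
  apply: measurable_funTS.
  exact: (measurableT_comp (mG (dyadic n k)) measurable_snd).
rewrite /Gn/=; apply: (cvg_comp _ (G ^~ w)); last exact: cG.
have [v0|v0] := leP 0 v; first exact: cvg_dyadic_index.
have E n : dyadic n (dyadic_index n v) = 0 :> R.
  rewrite /dyadic (_ : dyadic_index n v = 0%N) ?mul0r//.
  apply/eqP; rewrite -leqn0 truncn_le_nat.
  have h : v * 2 ^+ n < 0 by rewrite pmulr_llt0// exprn_gt0.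
  exact: lt_trans h ltr01.
have -> : (fun n => dyadic n (dyadic_index n v)) = (fun=> 0 : R).
  by apply/funext => n; exact: E.

exact: cvg_cst.
Qed.

(** Fubini-Tonelli applied to the positive and negative parts separately. *)
Lemma measurable_Rintegral01 (k : measurableTypeR R * T -> R) :
  measurable_fun setT k ->
  measurable_fun setT (fun w => \int[mu]_(v in `[0, 1]) k (v, w)).
Proof.
move=> mk; pose D : set (measurableTypeR R) := `[0, 1]%classic.
have mD : measurable D by exact: measurable_itv.
have m1 (f : measurableTypeR R * T -> R) : measurable_fun setT f ->
    measurable_fun setT (fun w => \int[mu]_(v in D) (maxe (f (v, w))%:E 0))%E.
  move=> mf.
  pose g (z : measurableTypeR R * T) := ((\1_D z.1)%:E * maxe (f z)%:E 0)%E.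
  have mg : measurable_fun setT g.
    apply: emeasurable_funM; last first.
      by apply: measurable_maxe => //; exact/measurable_EFinP.
    by apply/measurable_EFinP; apply: measurableT_comp.
  have g0 z : (0 <= g z)%E by rewrite mule_ge0// ?lee_fin// le_max lexx orbT.
  have := @measurable_fun_fubini_tonelli_G _ _ _ _ R mu g mg g0.
  congr (measurable_fun _ _); apply/funext => w; rewrite /fubini_G /g.
  rewrite [RHS]integral_mkcond; apply: eq_integral => v _.
  by rewrite patchE indicE; case: ifP => _; rewrite ?mul1e ?mul0e.
have -> : (fun w => \int[mu]_(v in `[0, 1]) k (v, w)) = fine \o
  (fun w => \int[mu]_(v in D) (maxe (k (v, w))%:E 0) -
            \int[mu]_(v in D) (maxe (- k (v, w))%:E 0))%E.
  apply/funext => w; rewrite /Rintegral/= integralE; congr (fine (_ - _)).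
    by apply: eq_integral => v _; rewrite funeposE.
  by apply: eq_integral => v _; rewrite funenegE.
apply: measurableT_comp; first exact: fine_measurable.
apply: emeasurable_funB; first exact: m1.
by apply: (m1 (fun z => - k z)); exact: measurableT_comp.
Qed.

Lemma measurable_scaled_derivative (alpha : R) (B : R -> T -> R) s h :
  (forall t, measurable_fun setT (B t)) -> (forall w, continuous (B ^~ w)) ->
  measurable_fun setT (fun w => scaled_derivative alpha (B ^~ w) s h).
Proof.
move=> mB cB; apply: measurable_funD; first exact: measurable_funB.
apply: measurable_funM => //.
pose k (z : measurableTypeR R * T) :=
  (B s z.2 - B (s + h * Num.max 0 z.1) z.2) * z.1 `^ (alpha - 2).
have mk : measurable_fun setT k.
  apply: measurable_funM.
    apply: (@measurable_continuous_process
      (fun v w => B s w - B (s + h * v) w)).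
      by move=> t; exact: measurable_funB.
    move=> w v; apply: cvgB; first exact: cvg_cst.
    apply: (cvg_comp _ (B ^~ w)); last exact: cB.
    by apply: cvgD; [exact: cvg_cst|apply: cvgM => //; exact: cvg_cst].
  have mp : measurable_fun setT (fun v : measurableTypeR R => v `^ (alpha - 2)).
    exact: (@measurable_powR R (alpha - 2)).
  exact: (measurableT_comp mp measurable_fst).
have := measurable_Rintegral01 mk.
congr (measurable_fun _ _); apply/funext => w; apply: eq_Rintegral => v.
by rewrite inE/= in_itv/= => /andP[v0 _]; rewrite /k/= (max_idPr v0).
Qed.

End joint_measurability.
(** * The supremum over dyadic parameters *)

Section dyadic_supremum.
Context {R : realType}.
Variables (H alpha gamma : R).
Hypotheses (aH : 1 - H < alpha) (a1 : alpha < 1) (gamma0 : 0 <= gamma).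

(** An enumeration of the values of the ratio at dyadic parameters; the value
    [0] at the other indices is harmless because the ratio is nonnegative. *)
Definition dyadic_ratio (x : R -> R) (p : nat) : \bar R :=
  if unpickle p is Some (n, k, j) then
    if (0 < j <= 2 ^ n)%N then
      (xi_ratio H alpha gamma x (dyadic n k) (dyadic n j))%:E
    else 0
  else 0.

Section path.
Variables (x : R -> R) (A : R).
Hypotheses (cx : continuous x) (A0 : 0 <= A) (mx : has_modulus H gamma x A).

Lemma cvg_xi_ratio (s_ h_ : nat -> R) (s h : R) :
  0 <= s -> 0 < h <= 1 ->
  (forall n, 0 <= s_ n <= s) -> (forall n, 0 < h_ n <= 1) ->
  s_ @ \oo --> s -> h_ @ \oo --> h ->
  xi_ratio H alpha gamma x (s_ n) (h_ n) @[n --> \oo] -->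
  xi_ratio H alpha gamma x s h.
Proof.
move=> s0 h01 s_s h_1 cs ch; have /andP[h0 h1] := h01.
have l0 : 0 < ln (s + h + 2) by rewrite ln_gt0//; lra.
have w0 : 0 < osc H h * ln (s + h + 2) `^ gamma.
  rewrite mulr_gt0//; last by rewrite powR_gt0.
  by rewrite mulr_gt0 ?powR_gt0// ltr_wpDl// sqrtr_ge0.
have cl (u : nat -> R) (l : R) : 0 < l -> u @ \oo --> l ->
    ln (u n) @[n --> \oo] --> ln l.
  by move=> l1 ul; apply: (cvg_comp _ (@ln R) ul); exact: continuous_ln.
have cp (q : R) (u : nat -> R) (l : R) : 0 < l -> u @ \oo --> l ->
    u n `^ q @[n --> \oo] --> l `^ q.
  move=> l1 ul; apply: (cvg_comp _ (fun v : R => v `^ q) ul).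
  exact: powR_continuous.
apply: cvgM.
  apply: cvgM; first exact: cvg_cst.
  exact: (cvg_norm (cvg_scaled_derivative aH a1 gamma0 cx A0 mx s0 h01
    s_s h_1 cs ch)).
apply: cvgV; first by rewrite gt_eqF.
apply: cvgM; last first.
  by apply: cp => //; apply: cl; [lra|do 2!apply: cvgD => //; exact: cvg_cst].
apply: cvgM; first exact: cp.
apply: cvgD; last exact: cvg_cst.
apply: (cvg_comp _ (@Num.sqrt R)); last exact: sqrt_continuous.
by apply: cvg_norm; exact: cl.
Qed.

(** The dyadic approximations of [s] and [h] from below are admissible
    parameters as soon as the level is so large that [2 ^- N < h]. *)
Lemma xi_ratio_le_dyadic (s h : R) : 0 <= s -> 0 < h <= 1 ->
  ((xi_ratio H alpha gamma x s h)%:E <= esups (dyadic_ratio x) 0%N)%E.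
Proof.
move=> s0 h01; have /andP[h0 h1] := h01.
have [N /(_ N (leqnn N)) hN] := dyadic_step_lt h0.
pose s_ n := dyadic (n + N) (dyadic_index (n + N) s) : R.
pose h_ n := dyadic (n + N) (dyadic_index (n + N) h) : R.
have s_s n : 0 <= s_ n <= s by rewrite dyadic_ge0 dyadic_index_le.
have h_0 n : 0 < h_ n.
  have := dyadic_index_gt (n + N) (ltW h0); rewrite -/(h_ n).
  have : (2 ^- (n + N) : R) <= (2^-1) ^+ N.
    rewrite exprVn lef_pV2 ?posrE ?exprn_gt0//.
    by rewrite ler_eXn2l ?leq_addl// ltr1n.
  by lra.
have h_1 n : 0 < h_ n <= 1.
  by rewrite h_0/= (le_trans _ h1)//; apply: dyadic_index_le; exact: ltW.
have cvN (u : R) : 0 <= u ->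
    dyadic (n + N) (dyadic_index (n + N) u) @[n --> \oo] --> u.
  by move=> u0; have := cvg_dyadic_index u0; rewrite -(cvg_shiftn N).
have c := cvg_xi_ratio s0 h01 s_s h_1 (cvN _ s0) (cvN _ (ltW h0)).
have ub n : ((xi_ratio H alpha gamma x (s_ n) (h_ n))%:E <=
    esups (dyadic_ratio x) 0%N)%E.
  apply: ereal_sup_ubound.
  exists (pickle ((n + N)%N, dyadic_index (n + N) s,
    dyadic_index (n + N) h)) => //.
  rewrite /dyadic_ratio pickleK ifT//; apply/andP; split.
    rewrite lt0n; apply/eqP => i0; have := h_0 n.
    by rewrite /h_ i0 /dyadic mul0r ltxx.
  rewrite -(ler_nat R) natrX -[leRHS]mul1r -ler_pdivrMr ?exprn_gt0//.
  by have /andP[] := h_1 n.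
have cE : (xi_ratio H alpha gamma x (s_ n) (h_ n))%:E @[n --> \oo] -->
    (xi_ratio H alpha gamma x s h)%:E.
  by apply: cvg_EFin => //; exact: nearW.
rewrite -(cvg_lim _ cE)//; apply: lime_le; first exact: cvgP cE.
exact: nearW.
Qed.

End path.

Variables (T : Type) (B : R -> T -> R) (w : T) (A : R).
Hypotheses (cB : continuous (B ^~ w)) (A0 : 0 <= A).
Hypothesis mB : has_modulus H gamma (B ^~ w) A.

Lemma xi_ge (s h : R) : 0 <= s -> 0 < h <= 1 ->
  ((xi_ratio H alpha gamma (B ^~ w) s h)%:E <= xi H alpha gamma B w)%E.
Proof.
move=> s0 h01; have /andP[h0 h1] := h01.
have sh : s + h - s = h by ring.
apply: ereal_sup_ubound; exists (s, s + h).
  by split => //=; rewrite ltrDl h0 lerD2l.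
by rewrite -(xi_ratioE aH a1 gamma0 cB A0 mB)// [(s, s + h).2]/(s + h) sh.
Qed.

Lemma xi_le (M : \bar R) :
  (forall s h, 0 <= s -> 0 < h <= 1 ->
    ((xi_ratio H alpha gamma (B ^~ w) s h)%:E <= M)%E) ->
  (xi H alpha gamma B w <= M)%E.
Proof.
move=> leM; apply: ge_ereal_sup => _ [[t1 t2] /= [t10 /andP[t12 t21]] <-].
have h01 : 0 < t2 - t1 <= 1 by apply/andP; split; lra.
have := leM t1 (t2 - t1) t10 h01.
by rewrite -(xi_ratioE aH a1 gamma0 cB A0 mB)// (addrC t1) subrK.
Qed.

Lemma xi_ge0 : (0 <= xi H alpha gamma B w)%E.
Proof.
have h01 : 0 < (1 : R) <= 1 by rewrite ltr01 lexx.
apply: le_trans (xi_ge (lexx 0) h01).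
by rewrite lee_fin; apply: xi_ratio_ge0.
Qed.

(** Dyadic parameters are admissible, which is one inequality; the other one is
    continuity of the ratio along dyadic approximations. *)
Lemma xi_esups : xi H alpha gamma B w = esups (dyadic_ratio (B ^~ w)) 0.
Proof.
apply/eqP; rewrite eq_le; apply/andP; split.
  by apply: xi_le => s h; exact: (xi_ratio_le_dyadic cB A0 mB).
apply: ge_ereal_sup => _ [p _ <-]; rewrite /dyadic_ratio.
case: unpickle => [[[n k] j]|]; last exact: xi_ge0.
case: ifP => [/andP[j0 jn]|_]; last exact: xi_ge0.
apply: xi_ge; first exact: dyadic_ge0.
have p2 : 0 < 2 ^+ n :> R by rewrite exprn_gt0.
rewrite /dyadic divr_gt0 ?ltr0n//= ler_pdivrMr// mul1r -natrX ler_nat//.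
Qed.

Lemma xi_le_modulus :
  (xi H alpha gamma B w <=
   (`|(Gamma alpha)^-1| * derivative_constant H alpha * A)%:E)%E.
Proof. by apply: xi_le => s h s0 h01; rewrite lee_fin; exact: xi_ratio_le. Qed.

End dyadic_supremum.

Section measurable_supremum.
Context {R : realType} {d : measure_display} {T : measurableType d}.

Lemma measurable_dyadic_supremum (H alpha gamma : R) (B : R -> T -> R) :
  (forall t, measurable_fun setT (B t)) -> (forall w, continuous (B ^~ w)) ->
  measurable_fun setT (fun w => esups (dyadic_ratio H alpha gamma (B ^~ w)) 0).
Proof.
move=> mB cB.
apply: (@measurable_fun_esups _ _ _ _
  (fun p w => dyadic_ratio H alpha gamma (B ^~ w) p)) => p.
rewrite /dyadic_ratio; case: (unpickle p) => [[[n k] j]|] //.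
case: (0 < j <= 2 ^ n)%N => //; apply/measurable_EFinP.
apply: measurable_funM => //; apply: measurable_funM => //.
by apply: measurableT_comp => //; exact: measurable_scaled_derivative.
Qed.

End measurable_supremum.
(** * Restriction to nonnegative times *)

Section nonnegative_time.
Context {R : realType}.

Definition extend_path (x : R -> R) (t : R) : R := x (Num.max 0 t).

Lemma extend_pathE (x : R -> R) t : 0 <= t -> extend_path x t = x t.
Proof. by move=> t0; rewrite /extend_path (max_idPr t0). Qed.

Lemma extend_path_continuous (x : R -> R) :
  locally_holder x -> continuous (extend_path x).
Proof.
move=> hx t; have [b [C [b0 xC]]] := hx (`|t| + 1).
apply/cvgrPdist_le => e e0.
pose D : R := `|C| + 1.
have D0 : 0 < D by rewrite ltr_wpDl.
pose r := Num.min 1 ((e / D) `^ b^-1).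
have r0 : 0 < r by rewrite lt_min ltr01 powR_gt0// divr_gt0.
near=> u.
have ur : `|t - u| <= r by near: u; apply: cvgr_dist_le => //; exact: cvg_id.
have maxl (v : R) : `|v| <= `|t| + 1 -> 0 <= Num.max 0 v <= `|t| + 1.
  move=> vt; rewrite le_max lexx/= ge_max addr_ge0//=.
  exact: le_trans (ler_norm v) vt.
have ut : `|u| <= `|t| + 1.
  rewrite -[u](subKr t); apply: le_trans (ler_normB _ _) _.
  by rewrite lerD2l (le_trans ur)// ge_min lexx.
have tt : `|t| <= `|t| + 1 by rewrite lerDl.
apply: le_trans (xC _ _ (maxl _ ut) (maxl _ tt)) _.
have du : `|Num.max 0 t - Num.max 0 u| <= `|t - u|.
  have := ler_norm (t - u); have := ler_norm (u - t); rewrite (distrC u t).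
  case: (leP 0 t) => t0; case: (leP 0 u) => u0 // h1 h2.
  - by rewrite subr0 ger0_norm//; lra.
  - by rewrite sub0r normrN ger0_norm//; lra.
  - by rewrite subrr normr0.
apply: (@le_trans _ _ (D * `|t - u| `^ b)).
  apply: (@le_trans _ _ (D * `|Num.max 0 t - Num.max 0 u| `^ b)).
    rewrite ler_wpM2r ?powR_ge0// /D; have := ler_norm C; lra.
  by rewrite ler_wpM2l ?(ltW D0)// ge0_ler_powR ?nnegrE ?(ltW b0).
rewrite -ler_pdivlMl// mulrC.
have eD : 0 <= e / D by rewrite divr_ge0 ?ltW.
have -> : e / D = ((e / D) `^ b^-1) `^ b.
  by rewrite -powRrM mulVf ?gt_eqF// powRr1.
rewrite ge0_ler_powR ?nnegrE ?(ltW b0) ?powR_ge0//.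
by apply: le_trans ur _; rewrite ge_min lexx orbT.
Unshelve. all: by end_near. Qed.

Lemma Z_extend_path (alpha : R) (x : R -> R) t1 t2 : 0 <= t1 -> t1 < t2 ->
  Z alpha (extend_path x) t1 t2 = Z alpha x t1 t2.
Proof.
move=> t10 t12; rewrite /Z !extend_pathE//; last first.
  by rewrite ltW// (le_lt_trans t10).
congr (_ * (_ + _ * _)%:C)%C; apply: eq_Rintegral => u.
rewrite inE/= in_itv/= => /andP[t1u _]; rewrite extend_pathE//.
exact: le_trans t1u.
Qed.

Lemma xi_extend_path {T : Type} (H alpha gamma : R) (B : R -> T -> R) (w : T) :
  xi H alpha gamma (fun t w => extend_path (B ^~ w) t) w = xi H alpha gamma B w.
Proof.
rewrite /xi; congr ereal_sup; apply: eq_imagel => t [t10 /andP[t12 _]].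
congr (Normc.normc _ / _)%:E; exact: (Z_extend_path alpha (B ^~ w) t10 t12).
Qed.

End nonnegative_time.

Section extended_fbm.
Context {R : realType} {d : measure_display} {T : measurableType d}.
Variables (P : probability T R) (H : R) (B : R -> T -> R).

Lemma fbm_extend_path : fbm P H B ->
  fbm P H (fun t w => extend_path (B ^~ w) t).
Proof.
move=> [gB eB cB hB].
have BE t : 0 <= t -> (fun w => extend_path (B ^~ w) t) = B t.
  by move=> t0; apply/funext => w; rewrite extend_pathE.
split.
- move=> n t a t0; have := gB n t a t0.
  congr (is_gaussian _ _); apply/funext => w; apply: eq_bigr => i _.
  by rewrite extend_pathE.
- by move=> t t0; rewrite BE// eB.
- by move=> s t s0 t0; rewrite !BE// cB.
- move=> w M; have [b [C [b0 h]]] := hB w M; exists b, C; split => // s t sM tM.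
  have /andP[s0 _] := sM; have /andP[t0 _] := tM.
  by rewrite !extend_pathE//; exact: h.
Qed.

End extended_fbm.

(** * Exponential moments and conclusion *)

Section exponential_moment.
Context {R : realType} {d : measure_display} {T : measurableType d}.

(** For [x < M^-1] the exponential of [x * X ^ 2] is at most
    [expR r * (1 + S)].  The integrand agrees almost everywhere with a real
    exponential, so completeness makes it measurable. *)
Lemma integral_expeR_sqr_lty (P : probability T R) (X S : T -> \bar R)
    (M r x : R) :
  measure_is_complete P -> measurable_fun setT X -> measurable_fun setT S ->
  (forall w, 0 <= S w)%E -> (\int[P]_w S w < +oo)%E ->
  0 < M -> x < M^-1 -> 0 <= r ->
  {ae P, forall w, exists2 q, X w = q%:E &
     exists2 s, S w = s%:E & q ^+ 2 <= M * (ln (1 + s) + r)} ->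
  (\int[P]_w expeR (x%:E * X w ^+ 2) < +oo)%E.
Proof.
move=> cP mX mS S0 iS M0 xM r0 aeX.
pose g w := (expR (x * fine (X w) ^+ 2))%:E : \bar R.
have mg : measurable_fun setT g.
  apply/measurable_EFinP; apply: measurableT_comp => //.
  apply: measurable_funM => //; apply: measurable_funX.
  by apply: measurableT_comp => //; exact: fine_measurable.
have m1 : measurable_fun setT (fun w => (expR r)%:E * (1 + S w))%E.
  by apply: emeasurable_funM => //; exact: emeasurable_funD.
have aeg : ae_eq P setT g (fun w => expeR (x%:E * X w ^+ 2)%E).
  apply: filterS aeX => w [q Xq _] _; rewrite /g Xq.
  by rewrite -EFin_expe -EFinM.
rewrite -(ge0_ae_eq_integral measurableT mg
    (ae_measurable_fun cP aeg mg) _ _ aeg);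
  [|by move=> w _; rewrite ?lee_fin ?expR_ge0 ?expeR_ge0..].
apply: (@le_lt_trans _ _ (\int[P]_w ((expR r)%:E * (1 + S w)))%E).
  apply: ae_ge0_le_integral => //.
  - by move=> w _; rewrite lee_fin expR_ge0.
  - by move=> w _; rewrite mule_ge0 ?lee_fin ?expR_ge0// adde_ge0.
  apply: filterS aeX => w [q Xq [s Ss qs]] _.
  rewrite /g Xq Ss -EFinD -EFinM lee_fin/=.
  have s1 : 0 < 1 + s by rewrite ltr_wpDr// -lee_fin -Ss.
  have E : 1 + s = expR (ln (1 + s)) by rewrite lnK ?posrE.
  rewrite [X in _ <= _ * X]E -expRD ler_expR.
  have l0 : 0 <= ln (1 + s) + r.
    by rewrite addr_ge0// ln_ge0// lerDl -lee_fin -Ss.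
  have [x0|x0] := leP x 0.
    by rewrite addrC; apply: le_trans l0; rewrite mulr_le0_ge0 ?sqr_ge0.
  apply: (@le_trans _ _ (M^-1 * (M * (ln (1 + s) + r)))).
    by rewrite ler_pM ?(ltW x0) ?(ltW xM) ?sqr_ge0.
  by rewrite mulKf ?gt_eqF// addrC.
rewrite ge0_integralZl//=; last 2 first.
- exact: emeasurable_funD.
- by move=> w _; rewrite adde_ge0.
rewrite ge0_integralD//= integral_cst//= probability_setT mule1.
by rewrite lte_mul_pinfty ?lee_fin ?expR_ge0// lte_add_pinfty// ltry.
Qed.

End exponential_moment.

Theorem theorem1 (R : realType) (H alpha gamma : R)
    (hH : 2^-1 < H < 1) (halpha : 1 - H < alpha < 2^-1)
    (hgamma : 2^-1 < gamma) :
  exists c : R, 0 < c /\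
    forall (d : measure_display) (T : measurableType d) (P : probability T R)
           (B : R -> T -> R),
      measure_is_complete P -> fbm P H B ->
      [/\ measurable_fun setT (xi H alpha gamma B),
          {ae P, forall w, xi H alpha gamma B w \is a fin_num}
        & forall x : R, x < c ->
            (\int[P]_w expeR (x%:E * xi H alpha gamma B w ^+ 2) < +oo)%E].
Proof.
have /andP[H12 H1] := hH; have /andP[aH a12] := halpha.
have H0 : 0 < H by lra.
have a1 : alpha < 1 by lra.
have g0 : 0 <= gamma by lra.
have g12 : 2^-1 <= gamma by exact: ltW.
pose Ceta : R := 8 / std_density_lb * 2 `^ (2 * gamma).
have Ceta0 : 0 < Ceta.
  by rewrite mulr_gt0 ?powR_gt0// divr_gt0// std_density_lb_gt0.
pose K : R :=
  `|(Gamma alpha)^-1| * derivative_constant H alpha * chaining_constant H.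
pose M : R := K ^+ 2 * Ceta + 1.
have M0 : 0 < M by rewrite ltr_wpDl// mulr_ge0 ?sqr_ge0// ltW.
exists M^-1; split; first by rewrite invr_gt0.
move=> d T P B0 cP fB0.
pose B t w := extend_path (B0 ^~ w) t.
have fB : fbm P H B by exact: fbm_extend_path.
have cB w : continuous (B ^~ w).
  by have [_ _ _ hB] := fB0; exact: (extend_path_continuous (hB w)).
have mB t : measurable_fun setT (B t).
  have : measurable_fun setT (B (Num.max 0 t)).
    by apply: (fbm_measurable fB); rewrite le_max lexx.
  congr (measurable_fun _ _); apply/funext => w.
  by rewrite /B /extend_path maxA maxxx.
rewrite (_ : xi H alpha gamma B0 = xi H alpha gamma B); last first.
  by apply/funext => w; rewrite xi_extend_path.
pose S w := dyadic_energy H (B ^~ w).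
have mS : measurable_fun setT S by exact: (measurable_dyadic_energy fB).
have S0 w : (0 <= S w)%E by exact: dyadic_energy_ge0.
have iS : (\int[P]_w S w < +oo)%E.
  exact: le_lt_trans (integral_dyadic_energy_le H0 fB) (ltry _).
have aeS : {ae P, forall w, S w \is a fin_num}.
  have : P.-integrable setT S.
    apply/integrableP; split => //.
    by under eq_integral do rewrite gee0_abs//.
  move=> /(integrable_ae measurableT); apply: filterS => w; exact.
pose eta s := Num.sqrt (Ceta * (ln (1 + s) + 6)) : R.
have good w s : S w = s%:E -> 0 < s /\
    has_modulus H gamma (B ^~ w) (eta s * chaining_constant H).
  move=> Sw; have [s0 dm] := dyadic_energy_modulus g12 Sw; split => //.
  exact: (dyadic_modulus_continuity H12 (ltW H1) g0 (cB w) (sqrtr_ge0 _) dm).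
have A0 s : 0 <= eta s * chaining_constant H.
  by rewrite mulr_ge0 ?sqrtr_ge0// ltW// chaining_constant_gt0.
pose X w := esups (dyadic_ratio H alpha gamma (B ^~ w)) 0.
have aeX : {ae P, forall w, xi H alpha gamma B w = X w}.
  apply: filterS aeS => w /fineK Sw; have [_ hm] := good w _ (esym Sw).
  exact: (xi_esups aH a1 g0 (cB w) (A0 _) hm).
have mX : measurable_fun setT (xi H alpha gamma B).
  apply: (ae_measurable_fun cP _
    (measurable_dyadic_supremum H alpha gamma mB cB)).
  by apply: filterS aeX => w /= ->.
have bound w s : S w = s%:E -> exists2 q, xi H alpha gamma B w = q%:E &
    q ^+ 2 <= M * (ln (1 + s) + 6).
  move=> Sw; have [s0 hm] := good w _ Sw.
  have x0 := xi_ge0 aH a1 g0 (cB w) (A0 s) hm.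
  have x1 := xi_le_modulus aH a1 g0 (cB w) (A0 s) hm.
  have xf : xi H alpha gamma B w \is a fin_num.
    by rewrite ge0_fin_numE// (le_lt_trans x1)// ltry.
  move: x0 x1; rewrite -(fineK xf); set q := fine _; rewrite !lee_fin => q0 q1.
  exists q => //.
  have l0 : 0 <= ln (1 + s) + 6 by rewrite addr_ge0// ln_ge0// lerDl ltW.
  apply: (@le_trans _ _ ((K * eta s) ^+ 2)).
    rewrite lerXn2r ?nnegrE//; last by rewrite /K; apply: le_trans q1 _; lra.
    by apply: (le_trans q0); rewrite /K; lra.
  rewrite exprMn sqr_sqrtr; last by rewrite mulr_ge0// ltW.
  rewrite mulrA ler_wpM2r// /M; lra.
split => //.
  apply: filterS aeS => w /fineK Sw; have [q -> _] := bound w _ (esym Sw).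
  by [].
move=> x xc; apply: (@integral_expeR_sqr_lty _ _ _ P _ S M 6) => //.
apply: filterS aeS => w /fineK Sw; have [q qE qle] := bound w _ (esym Sw).
by exists q => //; exists (fine (S w)).
Qed.
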